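(* Let $n\ge1$. The maximal multiplicity at $\mathbf{1}=(1,\dots,1)\in(\mathbb{C}^* )^n$ of a polynomial system with codimension $m=1$ and dimension $n$ is equal to $n+1$. That is, $n+1$ is the maximum of the multiplicities of $\mathbf{1}$ as an isolated solution of systems $$\sum_{j=0}^{n+1}c_{ij}x^{a_j}=0,\quad i=1,\dots,n,$$ over all sets $\mathcal{A}=\{a_0,\dots,a_{n+1}\}\subset\mathbb{Z}^n$ of $n+2$ points not contained in an affine hyperplane and all matrices $C=(c_{ij})\in\mathbb{C}^{n\times(n+2)}$ of rank $n$ for which $\mathbf{1}$ is an isolated solution.
   Context: $x^{a}=\prod_{i}x_i^{a_i}$ for $a=(a_1,\dots,a_n)$. The dimension of the system is the number $n$ of variables (the support $\mathcal{A}$ affinely spans $\mathbb{R}^n$) and its codimension is $m=|\mathcal{A}|-(n+1)$. The multiplicity of an isolated solution is the complex dimension of the localization at that point of the quotient of the Laurent polynomial ring by the ideal generated by the equations. *)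

(* Defs.v *)
From HB Require Import structures.
From mathcomp Require Import all_boot all_order all_algebra.
From mathcomp Require Import generic_quotient ring_quotient fraction.
From mathcomp Require Import ring.
From mathcomp Require Import mpoly complex.
From mathcomp Require Import boolp reals.

Set Implicit Arguments.
Unset Strict Implicit.
Unset Printing Implicit Defensive.

Import Order.TTheory GRing.Theory Num.Theory.
Local Open Scope ring_scope.
Local Open Scope quotient_scope.

Notation "p %:F" := (FracField.tofrac p) : ring_scope.

(* Laurent polynomials form the subring of the field of fractions of          *)
(* K[x_1, .., x_n] consisting of the fractions p / x^m with x^m a monomial.    *)
Section Laurent.
Variables (K : fieldType) (n : nat).
Local Notation frac := {fraction {mpoly K[n]}}.

Definition laurent_pred : {pred frac} := fun f =>
  `[< exists (p : {mpoly K[n]}) (m : 'X_{1..n}), f = p%:F / ('X_[m])%:F >].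

Lemma laurent_predP (f : frac) :
  reflect (exists (p : {mpoly K[n]}) (m : 'X_{1..n}), f = p%:F / ('X_[m])%:F)
          (f \in laurent_pred).
Proof. exact: asboolP. Qed.

Lemma mpolyXF_neq0 (m : 'X_{1..n}) : ('X_[K, m])%:F != 0 :> frac.
Proof.
rewrite tofrac_eq0; apply/eqP => /(congr1 (fun p : {mpoly K[n]} => p@_m)).
by rewrite mcoeffX mcoeff0 eqxx => /eqP; rewrite oner_eq0.
Qed.

Fact laurent_subring : subring_closed laurent_pred.
Proof.
split=> [|f g /laurent_predP[p [m ->]] /laurent_predP[q [k ->]]
         |f g /laurent_predP[p [m ->]] /laurent_predP[q [k ->]]].
- by apply/laurent_predP; exists 1, 0%MM; rewrite mpolyX0 divff // tofrac_eq0 oner_eq0.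
- apply/laurent_predP; exists (p * 'X_[k] - q * 'X_[m]), (m + k)%MM.
  by rewrite mpolyXD rmorphB !rmorphM -[in LHS]mulNr addf_div ?mpolyXF_neq0 // mulNr.
apply/laurent_predP; exists (p * q), (m + k)%MM.
by rewrite mpolyXD !rmorphM mulf_div.
Qed.
HB.instance Definition _ :=
  GRing.isSubringClosed.Build frac laurent_pred laurent_subring.

Record laurent := Laurent { laurent_val :> frac; _ : laurent_val \in laurent_pred }.
HB.instance Definition _ := [isSub for laurent_val].
HB.instance Definition _ := [Choice of laurent by <:].
HB.instance Definition _ := [SubChoice_isSubComNzRing of laurent by <:].

Lemma laurent_poly_subproof (p : {mpoly K[n]}) : p%:F \in laurent_pred.
Proof.
by apply/laurent_predP; exists p, 0%MM; rewrite mpolyX0 tofrac1 divr1.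
Qed.
Definition laurent_poly (p : {mpoly K[n]}) : laurent :=
  Laurent (laurent_poly_subproof p).

Fact laurent_poly_zmod : zmod_morphism laurent_poly.
Proof. by move=> p q; apply: val_inj; rewrite /= rmorphB. Qed.
HB.instance Definition _ :=
  GRing.isZmodMorphism.Build {mpoly K[n]} laurent laurent_poly laurent_poly_zmod.
Fact laurent_poly_monoid : monoid_morphism laurent_poly.
Proof. by split=> [|p q]; apply: val_inj; rewrite /= ?rmorph1 ?rmorphM. Qed.
HB.instance Definition _ :=
  GRing.isMonoidMorphism.Build {mpoly K[n]} laurent laurent_poly laurent_poly_monoid.

Definition laurentC : {rmorphism K -> laurent} :=
  laurent_poly \o @mpolyC n K.

Lemma laurentX_subproof (a : 'rV[int]_n) :
  \prod_i (('X_i)%:F : frac) ^ (a 0 i) \in laurent_pred.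
Proof.
apply: rpred_prod => i _; case: (a 0 i) => k /=.
  by rewrite rpredX // laurent_poly_subproof.
apply/laurent_predP; exists 1, (U_(i) *+ k.+1)%MM.
by rewrite -mpolyXn tofracXn tofrac1 div1r NegzE -exprnN.
Qed.
Definition laurentX (a : 'rV[int]_n) : laurent := Laurent (laurentX_subproof a).

Record torus := Torus { torus_val :> 'rV[K]_n; _ : [forall i, torus_val 0 i != 0] }.
HB.instance Definition _ := [isSub for torus_val].

Lemma torus_neq0 (x : torus) i : (x : 'rV[K]_n) 0 i != 0.
Proof. by case: x => v /= /forallP. Qed.

Lemma torus1_subproof : [forall i, (const_mx 1 : 'rV[K]_n) 0 i != 0].
Proof. by apply/forallP => i; rewrite mxE oner_eq0. Qed.
Definition torus1 : torus := Torus torus1_subproof.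

Lemma laurent_numden (f : laurent) :
  exists pm : {mpoly K[n]} * 'X_{1..n}, val f = pm.1%:F / ('X_[pm.2])%:F.
Proof. by case: f => f /= /laurent_predP[p [m ->]]; exists (p, m). Qed.

Definition laurent_eval (x : torus) (f : laurent) : K :=
  let pm := projT1 (cid (laurent_numden f)) in
  pm.1.@[(x : 'rV[K]_n) 0] / ('X_[pm.2]).@[(x : 'rV[K]_n) 0].

Lemma mevalX_neq0 (x : torus) (m : 'X_{1..n}) :
  ('X_[m]).@[(x : 'rV[K]_n) 0] != 0.
Proof.
by rewrite mevalX; apply/prodf_neq0 => i _; rewrite expf_neq0 // torus_neq0.
Qed.

Lemma laurent_evalE (x : torus) (f : laurent) (p : {mpoly K[n]}) (m : 'X_{1..n}) :
  val f = p%:F / ('X_[m])%:F ->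
  laurent_eval x f = p.@[(x : 'rV[K]_n) 0] / ('X_[m]).@[(x : 'rV[K]_n) 0].
Proof.
rewrite /laurent_eval; case: cid => -[q k] /= -> /eqP.
rewrite eqr_div ?mpolyXF_neq0 // -!tofracM tofrac_eq => /eqP e.
by apply/eqP; rewrite eqr_div ?mevalX_neq0 // -!mevalM e.
Qed.

Fact laurent_eval_zmod x : zmod_morphism (laurent_eval x).
Proof.
move=> f g; have [[p m] /= ef] := laurent_numden f.
have [[q k] /= eg] := laurent_numden g.
rewrite (laurent_evalE x ef) (laurent_evalE x eg).
rewrite (@laurent_evalE x _ (p * 'X_[k] - q * 'X_[m]) (m + k)%MM).
  by rewrite mpolyXD mevalB !mevalM -[in RHS]mulNr addf_div ?mevalX_neq0 // mulNr.
by rewrite raddfB /= ef eg mpolyXD rmorphB !rmorphM -[in LHS]mulNr addf_div ?mpolyXF_neq0 // mulNr.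
Qed.
HB.instance Definition _ x :=
  GRing.isZmodMorphism.Build laurent K (laurent_eval x) (laurent_eval_zmod x).
Fact laurent_eval_monoid x : monoid_morphism (laurent_eval x).
Proof.
split=> [|f g].
  by rewrite (@laurent_evalE x 1 1 0%MM) ?mpolyX0 ?meval1 ?divr1 ?tofrac1 ?divr1.
have [[p m] /= ef] := laurent_numden f; have [[q k] /= eg] := laurent_numden g.
rewrite (laurent_evalE x ef) (laurent_evalE x eg).
rewrite (@laurent_evalE x _ (p * q) (m + k)%MM).
  by rewrite mpolyXD !mevalM mulf_div.
by rewrite rmorphM /= ef eg mpolyXD !rmorphM mulf_div.
Qed.
HB.instance Definition _ x :=
  GRing.isMonoidMorphism.Build laurent K (laurent_eval x) (laurent_eval_monoid x).

Lemma laurent_eval_poly x p :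
  laurent_eval x (laurent_poly p) = p.@[(x : 'rV[K]_n) 0].
Proof.
by rewrite (@laurent_evalE x _ p 0%MM) ?mpolyX0 ?meval1 ?divr1 //.
Qed.

Lemma laurent_evalC x c : laurent_eval x (laurentC c) = c.
Proof. by rewrite laurent_eval_poly mevalC. Qed.

Lemma laurent_evalX x a :
  laurent_eval x (laurentX a) = \prod_i ((x : 'rV[K]_n) 0 i) ^ (a 0 i).
Proof.
pose np (z : int) := if z is Posz k then k else 0%N.
pose nn (z : int) := if z is Negz k then k.+1 else 0%N.
have zE (F : fieldType) (u : F) z : u ^ z = u ^+ np z / u ^+ nn z.
  by case: z => k; rewrite /= ?expr0 ?divr1 ?div1r.
rewrite (@laurent_evalE x _ 'X_[[multinom np (a 0%R i) | i < n]]
                            [multinom nn (a 0%R i) | i < n]).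
  rewrite !mevalX -prodf_div; apply: eq_bigr => i _.
  by rewrite !mnmE zE.
rewrite /= !mpolyXE_id !rmorph_prod -prodf_div; apply: eq_bigr => i _.
by rewrite !mnmE !rmorphXn zE.
Qed.

End Laurent.

(* The quotient A / (F_0, .., F_(r-1)). The ring structure of {ideal_quot I}   *)
(* requires a proper ideal I; here it may be the zero ring.                   *)
Section GenQuotient.
Variables (A : comNzRingType) (r : nat) (F : 'I_r -> A).

Definition gen_ideal : {pred A} := fun f =>
  `[< exists g : 'I_r -> A, f = \sum_i g i * F i >].

Lemma gen_idealP f :
  reflect (exists g : 'I_r -> A, f = \sum_i g i * F i) (f \in gen_ideal).
Proof. exact: asboolP. Qed.

Fact gen_ideal_zmod : zmod_closed gen_ideal.
Proof.
split=> [|f g /gen_idealP[u ->] /gen_idealP[v ->]]; apply/gen_idealP.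
  by exists (fun=> 0); rewrite big1 // => i _; rewrite mul0r.
by exists (fun i => u i - v i); rewrite -sumrB; apply: eq_bigr => i _; rewrite mulrBl.
Qed.
HB.instance Definition _ := GRing.isZmodClosed.Build A gen_ideal gen_ideal_zmod.

Lemma gen_idealMl f g : g \in gen_ideal -> f * g \in gen_ideal.
Proof.
move=> /gen_idealP[v ->]; apply/gen_idealP; exists (fun i => f * v i).
by rewrite mulr_sumr; apply: eq_bigr => i _; rewrite mulrA.
Qed.

Definition gen_quot : Type := Quotient.quot gen_ideal.
HB.instance Definition _ := GRing.Zmodule.on gen_quot.
Definition gen_pi (f : A) : gen_quot := \pi_(Quotient.quot gen_ideal) f.

Lemma gen_piP f g : reflect (gen_pi f = gen_pi g) (f - g \in gen_ideal).
Proof. by rewrite Quotient.idealrBE; apply: eqP. Qed.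

Lemma gen_pi_surj (q : gen_quot) : exists f, gen_pi f = q.
Proof. by exists (repr (q : Quotient.quot gen_ideal)); exact: reprK. Qed.

Fact gen_pi_zmod : zmod_morphism gen_pi.
Proof. by move=> f g; rewrite /gen_pi raddfB. Qed.
HB.instance Definition _ :=
  GRing.isZmodMorphism.Build A gen_quot gen_pi gen_pi_zmod.

Definition gen_repr (q : gen_quot) : A := sval (cid (gen_pi_surj q)).

Lemma gen_reprK : cancel gen_repr gen_pi.
Proof. by move=> q; rewrite /gen_repr; case: cid. Qed.

Definition gen_mul (p q : gen_quot) : gen_quot :=
  gen_pi (gen_repr p * gen_repr q).

Lemma gen_piM f g : gen_pi (f * g) = gen_mul (gen_pi f) (gen_pi g).
Proof.
apply/gen_piP; set f' := gen_repr _; set g' := gen_repr (gen_pi g).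
have hf : f - f' \in gen_ideal by apply/gen_piP; rewrite gen_reprK.
have hg : g - g' \in gen_ideal by apply/gen_piP; rewrite gen_reprK.
have -> : f * g - f' * g' = g * (f - f') + f' * (g - g').
  by rewrite !mulrBr addrA [g * f']mulrC subrK [g * f]mulrC.
by rewrite rpredD // gen_idealMl.
Qed.

Fact gen_mulA : associative gen_mul.
Proof.
move=> p q s; rewrite -(gen_reprK p) -(gen_reprK q) -(gen_reprK s).
by rewrite -!gen_piM mulrA.
Qed.
Fact gen_mulC : commutative gen_mul.
Proof. by move=> p q; rewrite /gen_mul mulrC. Qed.
Fact gen_mul1 : left_id (gen_pi 1) gen_mul.
Proof. by move=> p; rewrite -(gen_reprK p) -gen_piM mul1r. Qed.
Fact gen_mulDl : left_distributive gen_mul +%R.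
Proof.
move=> p q s; rewrite -(gen_reprK p) -(gen_reprK q) -(gen_reprK s).
by rewrite -!gen_piM -!raddfD -gen_piM mulrDl.
Qed.
HB.instance Definition _ :=
  GRing.Zmodule_isComPzRing.Build gen_quot gen_mulA gen_mulC gen_mul1 gen_mulDl.

Fact gen_pi_monoid : monoid_morphism gen_pi.
Proof. by split=> // f g; exact: gen_piM. Qed.
HB.instance Definition _ :=
  GRing.isMonoidMorphism.Build A gen_quot gen_pi gen_pi_monoid.

End GenQuotient.

(* The localization S^-1 A: a / s = b / t iff u * (a * t - b * s) = 0 for     *)
(* some u in S. It is the zero ring when 0 is in S.                           *)
Section Localization.
Variables (A : comPzRingType) (S : mulrClosed A).

Local Notation pair := (A * {s : A | s \in S})%type.
Implicit Types x y z : pair.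
Local Notation num x := (x.1).
Local Notation den x := (sval x.2).

Lemma denP x : den x \in S. Proof. by case: x => a []. Qed.

Lemma denM_subproof x y : den x * den y \in S.
Proof. by rewrite rpredM ?denP. Qed.

Definition mkpair (a s : A) (sS : s \in S) : pair := (a, exist _ s sS).

Definition loc_equiv x y :=
  `[< exists2 u, u \in S & u * (num x * den y) = u * (num y * den x) >].

Lemma loc_equivP x y :
  reflect (exists2 u, u \in S & u * (num x * den y) = u * (num y * den x))
          (loc_equiv x y).
Proof. exact: asboolP. Qed.

Fact loc_equiv_refl : reflexive loc_equiv.
Proof. by move=> x; apply/loc_equivP; exists 1; rewrite ?rpred1. Qed.
Fact loc_equiv_sym : ssrbool.symmetric loc_equiv.
Proof.
by move=> x y; apply/loc_equivP/loc_equivP => -[u uS e]; exists u; rewrite ?e.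
Qed.
Fact loc_equiv_trans : transitive loc_equiv.
Proof.
move=> y x z /loc_equivP[u uS e] /loc_equivP[v vS f]; apply/loc_equivP.
exists (u * v * den y); first by rewrite !rpredM ?denP.
transitivity (v * den z * (u * (num x * den y))); first by ring.
rewrite e; transitivity (u * den x * (v * (num y * den z))); first by ring.
by rewrite f; ring.
Qed.
Canonical loc_equiv_rel :=
  EquivRel loc_equiv loc_equiv_refl loc_equiv_sym loc_equiv_trans.

Definition loc : Type := {eq_quot loc_equiv}.
HB.instance Definition _ := Choice.on loc.

Definition loc_pi (x : pair) : loc := \pi_({eq_quot loc_equiv}) x.
Definition loc_repr (a : loc) : pair := repr (a : {eq_quot loc_equiv}).

Lemma loc_piP x y : reflect (loc_pi x = loc_pi y) (loc_equiv x y).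
Proof. by apply: (iffP idP) => [e|/eqmodP//]; apply/eqmodP. Qed.

Lemma loc_reprK : cancel loc_repr loc_pi.
Proof. exact: reprK. Qed.

Lemma loc_repr_pi x : loc_equiv (loc_repr (loc_pi x)) x.
Proof. by apply/loc_piP; rewrite loc_reprK. Qed.

Definition addp x y : pair :=
  mkpair (num x * den y + num y * den x) (denM_subproof x y).
Definition mulp x y : pair :=
  mkpair (num x * num y) (denM_subproof x y).
Definition oppp x : pair := (- num x, x.2).
Definition inp (a : A) : pair := mkpair a (rpred1 S).

Definition loc_add (a b : loc) := loc_pi (addp (loc_repr a) (loc_repr b)).
Definition loc_mul (a b : loc) := loc_pi (mulp (loc_repr a) (loc_repr b)).
Definition loc_opp (a : loc) := loc_pi (oppp (loc_repr a)).
Definition loc_in (a : A) : loc := loc_pi (inp a).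

Lemma loc_addE x y : loc_add (loc_pi x) (loc_pi y) = loc_pi (addp x y).
Proof.
apply/loc_piP/loc_equivP; rewrite /loc_add.
case/loc_equivP: (loc_repr_pi x); set x' := loc_repr (loc_pi x) => u uS e.
case/loc_equivP: (loc_repr_pi y); set y' := loc_repr (loc_pi y) => v vS f.
exists (u * v); first by rewrite rpredM.
rewrite /addp /=.
transitivity (v * den y' * den y * (u * (num x' * den x)) +
              u * den x' * den x * (v * (num y' * den y))); first by ring.
by rewrite e f; ring.
Qed.

Lemma loc_mulE x y : loc_mul (loc_pi x) (loc_pi y) = loc_pi (mulp x y).
Proof.
apply/loc_piP/loc_equivP; rewrite /loc_mul.
case/loc_equivP: (loc_repr_pi x); set x' := loc_repr (loc_pi x) => u uS e.
case/loc_equivP: (loc_repr_pi y); set y' := loc_repr (loc_pi y) => v vS f.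
exists (u * v); first by rewrite rpredM.
rewrite /mulp /=.
transitivity ((u * (num x' * den x)) * (v * (num y' * den y))); first by ring.
by rewrite e f; ring.
Qed.

Lemma loc_oppE x : loc_opp (loc_pi x) = loc_pi (oppp x).
Proof.
apply/loc_piP/loc_equivP; rewrite /loc_opp.
case/loc_equivP: (loc_repr_pi x); set x' := loc_repr (loc_pi x) => u uS e.
by exists u => //=; rewrite !mulNr !mulrN e.
Qed.

Lemma loc_ind (P : loc -> Prop) : (forall x, P (loc_pi x)) -> forall a, P a.
Proof. by move=> h a; rewrite -(loc_reprK a). Qed.

Lemma loc_eq x y : num x * den y = num y * den x -> loc_pi x = loc_pi y.
Proof. by move=> e; apply/loc_piP/loc_equivP; exists 1; rewrite ?rpred1 ?e. Qed.

Fact loc_addA : associative loc_add.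
Proof.
elim/loc_ind=> x; elim/loc_ind=> y; elim/loc_ind=> z.
by rewrite !loc_addE; apply: loc_eq => /=; ring.
Qed.
Fact loc_addC : commutative loc_add.
Proof.
by elim/loc_ind=> x; elim/loc_ind=> y; rewrite !loc_addE; apply: loc_eq => /=; ring.
Qed.
Fact loc_add0 : left_id (loc_in 0) loc_add.
Proof. by elim/loc_ind=> x; rewrite loc_addE; apply: loc_eq => /=; ring. Qed.
Fact loc_addN : left_inverse (loc_in 0) loc_opp loc_add.
Proof. by elim/loc_ind=> x; rewrite loc_oppE loc_addE; apply: loc_eq => /=; ring. Qed.
HB.instance Definition _ :=
  GRing.isZmodule.Build loc loc_addA loc_addC loc_add0 loc_addN.

Fact loc_mulA : associative loc_mul.
Proof.
elim/loc_ind=> x; elim/loc_ind=> y; elim/loc_ind=> z.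
by rewrite !loc_mulE; apply: loc_eq => /=; ring.
Qed.
Fact loc_mulC : commutative loc_mul.
Proof.
by elim/loc_ind=> x; elim/loc_ind=> y; rewrite !loc_mulE; apply: loc_eq => /=; ring.
Qed.
Fact loc_mul1 : left_id (loc_in 1) loc_mul.
Proof. by elim/loc_ind=> x; rewrite loc_mulE; apply: loc_eq => /=; ring. Qed.
Fact loc_mulDl : left_distributive loc_mul loc_add.
Proof.
elim/loc_ind=> x; elim/loc_ind=> y; elim/loc_ind=> z.
by rewrite !(loc_addE, loc_mulE); apply: loc_eq => /=; ring.
Qed.
HB.instance Definition _ :=
  GRing.Zmodule_isComPzRing.Build loc loc_mulA loc_mulC loc_mul1 loc_mulDl.

Fact loc_in_zmod : zmod_morphism loc_in.
Proof.
move=> a b; rewrite -[RHS]/(loc_add (loc_in a) (loc_opp (loc_in b))).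
by rewrite loc_oppE loc_addE; apply: loc_eq => /=; ring.
Qed.
HB.instance Definition _ := GRing.isZmodMorphism.Build A loc loc_in loc_in_zmod.
Fact loc_in_monoid : monoid_morphism loc_in.
Proof.
split=> // a b; rewrite -[RHS]/(loc_mul (loc_in a) (loc_in b)).
by rewrite loc_mulE; apply: loc_eq => /=; ring.
Qed.
HB.instance Definition _ :=
  GRing.isMonoidMorphism.Build A loc loc_in loc_in_monoid.

End Localization.

(* B seen as a K-module through f. *)
Definition restr_scalars (K B : pzRingType) (f : {rmorphism K -> B}) : Type := B.

Section Restriction.
Variables (K B : pzRingType) (f : {rmorphism K -> B}).

Local Notation V := (restr_scalars f).
HB.instance Definition _ := GRing.Zmodule.on V.

Definition restr_scale (c : K) (x : V) : V := f c * (x : B).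

Fact restr_scaleA a b x :
  restr_scale a (restr_scale b x) = restr_scale (a * b) x.
Proof. by rewrite /restr_scale rmorphM mulrA. Qed.
Fact restr_scale1 : left_id 1 restr_scale.
Proof. by move=> x; rewrite /restr_scale rmorph1 mul1r. Qed.
Fact restr_scaleDr : right_distributive restr_scale +%R.
Proof. by move=> c x y; rewrite /restr_scale mulrDr. Qed.
Fact restr_scaleDl x : {morph restr_scale^~ x : a b / a + b}.
Proof. by move=> a b; rewrite /restr_scale rmorphD mulrDl. Qed.
HB.instance Definition _ := GRing.Zmodule_isLmodule.Build K V
  restr_scaleA restr_scale1 restr_scaleDr restr_scaleDl.

End Restriction.

(* For at most one d, by invariance of dimension; for none if V is infinite    *)
(* dimensional.                                                               *)
Definition has_dim (K : fieldType) (V : lmodType K) (d : nat) : Prop :=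
  exists phi : {linear V -> 'rV[K]_d}, bijective phi.

Section Multiplicity.
Variables (K : fieldType) (n r : nat) (F : 'I_r -> laurent K n) (x : torus K n).

(* The complement of the maximal ideal of the point x in the quotient ring,   *)
(* assuming that x is a common zero of F.                                     *)
Definition nonvanishing : {pred gen_quot F} := fun q =>
  `[< exists2 f, laurent_eval x f != 0 & q = gen_pi F f >].

Fact nonvanishing_mulr : mulr_closed nonvanishing.
Proof.
split=> [|_ _ /asboolP[f f0 ->] /asboolP[g g0 ->]]; apply/asboolP.
  by exists 1; rewrite ?rmorph1 ?oner_eq0.
by exists (f * g); rewrite ?rmorphM // mulf_neq0.
Qed.
HB.instance Definition _ :=
  GRing.isMulClosed.Build (gen_quot F) nonvanishing nonvanishing_mulr.

Definition local_ring : comPzRingType := loc nonvanishing.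

Definition local_ringC : {rmorphism K -> local_ring} :=
  @loc_in _ nonvanishing \o gen_pi F \o @laurentC K n.

Definition multiplicity (d : nat) : Prop :=
  has_dim (restr_scalars local_ringC) d.

End Multiplicity.

Section System.
Variables (R : realType) (n N r : nat).
Local Notation C := R[i].
Implicit Types (a : 'I_N -> 'rV[int]_n) (c : 'M[C]_(r, N)).

Definition system a c (i : 'I_r) : laurent C n :=
  \sum_(j < N) laurentC C n (c i j) * laurentX C (a j).

Definition is_solution a c (x : torus C n) : Prop :=
  forall i, \sum_(j < N) c i j * \prod_k ((x : 'rV[C]_n) 0 k) ^ (a j 0 k) = 0.

Lemma is_solutionE a c x :
  is_solution a c x <-> forall i, laurent_eval x (system a c i) = 0.
Proof.
have e i : laurent_eval x (system a c i) =
    \sum_(j < N) c i j * \prod_k ((x : 'rV[C]_n) 0 k) ^ (a j 0 k).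
  rewrite rmorph_sum; apply: eq_bigr => j _.
  by rewrite rmorphM /= laurent_evalC laurent_evalX.
by split=> h i; [rewrite e | rewrite -e]; exact: h.
Qed.

Definition isolated_solution a c (x : torus C n) : Prop :=
  is_solution a c x /\
  exists2 e : R, 0 < e &
    forall y : torus C n,
      (forall k, `|(y : 'rV[C]_n) 0 k - (x : 'rV[C]_n) 0 k| < e%:C%C) ->
      is_solution a c y -> y = x.

Definition in_affine_hyperplane a : Prop :=
  exists (w : 'rV[R]_n) (b : R),
    w != 0 /\ forall j, \sum_k w 0 k * (a j 0 k)%:~R = b.

End System.

(* Main.v *)
Require Import Defs.
From HB Require Import structures.
From mathcomp Require Import all_boot all_order all_algebra.
From mathcomp Require Import fraction.
From mathcomp Require Import ring zify.
From mathcomp Require Import mpoly complex.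
From mathcomp Require Import boolp reals.

Set Implicit Arguments.
Unset Strict Implicit.
Unset Printing Implicit Defensive.

Import Order.TTheory GRing.Theory Num.Theory.
Local Open Scope ring_scope.

(** Gale duality reduces the system to one equation in one variable. The kernel of
    the coefficient matrix is a plane; it contains the vector of ones because
    [(1, ..., 1)] is a solution, so it is spanned by this vector and some [v]
    ([kernel_through_ones]). After translation of the support by one of its
    points, the system therefore says that the monomials are linear forms
    [x^(b_j) = 1 + v_j T], where [T] is one of the monomials minus 1 and the vector
    [v] vanishes at one index.

    In the local ring at [(1, ..., 1)], the monomials are 1 modulo [T]. The
    exponents [b_j] span a lattice of finite index, hence the coordinates are 1
    modulo [T] too ([coordinates_eqmod1]): [T] generates the maximal ideal
    ([local_ring_residue]). If [T^k = 0], the local ring then has a basis made of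
    the first powers of [T], and its dimension is the least [d] with [T^d = 0]
    ([has_dim_uniformizer]).

    Upper bound. An integral relation between the [b_j] gives an equation
    [prod_j (1 + v_j T)^(p_j) = prod_j (1 + v_j T)^(q_j)]. Let [P] be the difference
    of the two sides as polynomials. Either [P] is nonzero, and its order of
    vanishing [k] at 0 is at most the number of nonzero [v_j], hence at most
    [n + 1]: the comparison of the logarithmic derivatives of the two sides
    leaves a numerator of degree less than this number ([order_lin_prodB]). As
    [P] is [T^k] times a unit, [T^k = 0]. Or [P = 0], and then the equations
    [x^(b_j) = 1 + v_j t] can be solved near [(1, ..., 1)] for all small numbers [t],
    by roots close to 1 ([curve_near_one]), so that the solution is not isolated.

    Sharpness. Write [1 + X + ... + X^n] as [prod_i (1 + v_i X)]. The system
    [x_i = 1 + v_i T] with [T = 1 - (x_1 ... x_n)^-1] has the support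
    [0, e_1, ..., e_n, - (e_1 + ... + e_n)], and implies [1 - T^(n+1) = 1]. That
    [T^n] is nonzero in the local ring is seen on the line [x_i = 1 + v_i X],
    where all the equations vanish to order [n + 1] ([extremal_T_neq0]). *)

(** * Algebras generated by a nilpotent element *)

(** When every element is a scalar modulo [t] and [t ^+ d] vanishes, peeling off
    residues one at a time expands any element along [1, t, ..., t ^+ d.-1]. The
    expansion is unique as soon as [t ^+ d.-1] is nonzero: in a vanishing
    combination, multiplying by the right power of [t] moves the first
    nonzero coefficient to [t ^+ d.-1] and kills all the later ones. *)
Lemma has_dim_uniformizer (K : fieldType) (B : comPzRingType)
    (f : {rmorphism K -> B}) (t : B) (d : nat) :
    (forall x, exists c y, x = f c + t * y) ->
    t ^+ d = 0 -> (forall i, (i < d)%N -> t ^+ i != 0) ->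
  has_dim (restr_scalars f) d.
Proof.
move=> res td0 tn0.
pose g (u : 'rV[K]_d) : restr_scalars f := \sum_(i < d) f (u 0 i) * t ^+ i.
have g_lin a u v : g (a *: u + v) = a *: g u + g v.
  transitivity (f a * (g u : B) + (g v : B)); last by [].
  rewrite /g mulr_sumr -big_split /=; apply: eq_bigr => i _.
  by rewrite !mxE rmorphD rmorphM mulrDl mulrA.
have g_inj u v : g u = g v -> u = v.
  move=> e; apply/eqP; rewrite -subr_eq0; apply/eqP.
  have {e} : g (u - v) = 0.
    by rewrite addrC -scaleN1r g_lin scaleN1r e addrC subrr.
  move: (u - v) => {u v} u gu0; apply/rowP => i; rewrite mxE.
  have [k] := ubnP (i : nat); elim: k => // k IHk in i * => /ltnSE le_ik.
  have := congr1 ( *%R^~ (t ^+ (d.-1 - i))) gu0.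
  have id1 : (i <= d.-1)%N by rewrite -ltnS prednK // (leq_ltn_trans _ (ltn_ord i)).
  rewrite /g mul0r mulr_suml (bigD1 i) //= big1 ?addr0 => [|j nij].
    rewrite -mulrA -exprD subnKC // => e; apply/eqP.
    have := tn0 d.-1; rewrite prednK ?(leq_ltn_trans _ (ltn_ord i)) //.
    move=> /(_ (leqnn d)).
    apply: contraNT => ui0; apply/eqP.
    by rewrite -[LHS]mul1r -(rmorph1 f) -(mulVf ui0) rmorphM -mulrA e mulr0.
  have [lt_ji|le_ij] := ltnP j i.
    by rewrite (IHk j) ?rmorph0 ?mul0r // (leq_trans lt_ji).
  have lt_ij : (i < j)%N by rewrite ltn_neqAle eq_sym nij.
  have dle : (d <= j + (d.-1 - i))%N by move: (ltn_ord i); lia.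
  by rewrite -mulrA -exprD -(subnKC dle) exprD td0 mul0r mulr0.
have g_surj x : exists u, g u = x.
  suff [c [y ->]] : exists (c : nat -> K) y,
      x = \sum_(i < d) f (c i) * t ^+ i + t ^+ d * y.
    exists (\row_i c i); rewrite td0 mul0r addr0.
    by apply: eq_bigr => i _; rewrite mxE.
  elim: d {td0 tn0 g g_lin g_inj} => [|k [c [y ->]]].
    by exists (fun=> 0), x; rewrite big_ord0 expr0 mul1r add0r.
  have [a [z ->]] := res y.
  exists (fun i => if i == k then a else c i), z.
  rewrite big_ord_recr /= eqxx -addrA; congr (_ + _).
    by apply: eq_bigr => i _; rewrite ltn_eqF.
  by rewrite exprS; ring.
pose h x := sval (cid (g_surj x)).
have gK x : g (h x) = x by rewrite /h; case: cid.
have h_lin : linear h.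
  by move=> a x y; apply: g_inj; rewrite g_lin !gK.
pose hL := GRing.isLinear.Build K (restr_scalars f) 'rV[K]_d *:%R h h_lin.
pose hM : {linear restr_scalars f -> 'rV[K]_d} := HB.pack h hL.
exists hM; exists g => [x|u]; first exact: gK.
by apply: g_inj; exact: gK.
Qed.

(** * Congruences modulo an element *)

Section CongruenceModulo.
Variables (B : comPzRingType) (t : B).
Implicit Types a b c : B.

Definition eqmodr a b := exists y, a = b + t * y.

Lemma eqmodr_refl a : eqmodr a a.
Proof. by exists 0; rewrite mulr0 addr0. Qed.

Lemma eqmodr_sym a b : eqmodr a b -> eqmodr b a.
Proof. by move=> [y ->]; exists (- y); rewrite mulrN addrK. Qed.

Lemma eqmodr_trans b a c : eqmodr a b -> eqmodr b c -> eqmodr a c.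
Proof. by move=> [y ->] [z ->]; exists (z + y); rewrite mulrDr addrA. Qed.

Lemma eqmodrD a b a' b' : eqmodr a b -> eqmodr a' b' -> eqmodr (a + a') (b + b').
Proof. by move=> [y ->] [z ->]; exists (y + z); ring. Qed.

Lemma eqmodrM a b a' b' : eqmodr a b -> eqmodr a' b' -> eqmodr (a * a') (b * b').
Proof. by move=> [y ->] [z ->]; exists (y * b' + b * z + t * y * z); ring. Qed.

(** Division by [b], of which only the residue [b'] has to be invertible. *)
Lemma eqmodr_div a b c b' c' d :
  a * b = c -> eqmodr b b' -> eqmodr c c' -> b' * d = 1 -> eqmodr a (c' * d).
Proof.
move=> <- bb' cc' b'd; apply: (@eqmodr_trans (a * b * d)).
  rewrite -[X in eqmodr X _]mulr1 -b'd mulrA; apply: eqmodrM (eqmodr_refl _).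
  by apply: eqmodrM (eqmodr_refl _) _; apply: eqmodr_sym.
by apply: eqmodrM (eqmodr_refl _).
Qed.

End CongruenceModulo.

(** * The local ring at a point of the torus *)

Section Germs.
Variables (K : fieldType) (n r : nat) (F : 'I_r -> laurent K n) (x : torus K n).

Definition germ : {rmorphism laurent K n -> local_ring F x} :=
  @loc_in _ (@nonvanishing K n r F x) \o gen_pi F.

Lemma germ_congr f g : f - g \in gen_ideal F -> germ f = germ g.
Proof. by move=> /gen_piP e; rewrite /germ /= e. Qed.

Lemma nonvanishingP u : laurent_eval x u != 0 ->
  gen_pi F u \in (@nonvanishing K n r F x).
Proof. by move=> ux0; apply/asboolP; exists u. Qed.

Lemma germ_unit u : laurent_eval x u != 0 -> exists v, germ u * v = 1.
Proof.
move=> ux0; exists (loc_pi (mkpair 1 (nonvanishingP ux0))).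
rewrite -[_ * _]/(loc_mul _ _) loc_mulE.
rewrite -[RHS]/(loc_pi (inp (@nonvanishing K n r F x) 1)).
by apply: loc_eq => /=; rewrite !mulr1 !mul1r.
Qed.

Lemma germ_frac o : exists f s, laurent_eval x s != 0 /\ o * germ s = germ f.
Proof.
elim/loc_ind: o => -[q [q' q'S]]; have /asboolP[s s0 es] := q'S.
have [f ef] := gen_pi_surj q; exists f, s; split=> //.
rewrite -[_ * _]/(loc_mul _ _) /germ /= /loc_in loc_mulE; apply: loc_eq => /=.
by rewrite ef -es mulr1 mulr1.
Qed.

Lemma germ_eq0 f : germ f = 0 ->
  exists2 u, laurent_eval x u != 0 & u * f \in gen_ideal F.
Proof.
move/loc_piP/loc_equivP => [_ /asboolP[u u0 ->]] /=; rewrite mulr1 mul0r mulr0.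
rewrite -rmorphM -(rmorph0 (gen_pi F)) => e; exists u => //.
by rewrite -[_ * _]subr0; apply/gen_piP.
Qed.

Lemma local_ringCM a b :
  local_ringC F x (a * b) = local_ringC F x a * local_ringC F x b.
Proof. exact: rmorphM. Qed.

Lemma local_ringC1 : local_ringC F x 1 = 1.
Proof. exact: rmorph1. Qed.

Lemma local_ringCV a : a != 0 -> local_ringC F x a * local_ringC F x a^-1 = 1.
Proof.
move=> a0; transitivity (local_ringC F x (a * a^-1)).
  exact/esym/local_ringCM.
rewrite (mulfV a0); exact: local_ringC1.
Qed.

Variable t : local_ring F x.
Hypothesis t_coord : forall i, eqmodr t
  (germ (laurent_poly 'X_i)) (local_ringC F x ((x : 'rV[K]_n) 0 i)).

(** The residue of a polynomial is its value, as soon as this holds for the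
    coordinates. *)
Lemma germ_poly_residue p :
  eqmodr t (germ (laurent_poly p)) (local_ringC F x p.@[(x : 'rV[K]_n) 0]).
Proof.
pose S p :=
  eqmodr t (germ (laurent_poly p)) (local_ringC F x p.@[(x : 'rV[K]_n) 0]).
have SD p1 p2 : S p1 -> S p2 -> S (p1 + p2).
  by rewrite /S mevalD !rmorphD; apply: eqmodrD.
have SM p1 p2 : S p1 -> S p2 -> S (p1 * p2).
  by rewrite /S mevalM !rmorphM; apply: eqmodrM.
have SC c : S c%:MP.
  by rewrite /S mevalC; exact: (eqmodr_refl t (local_ringC F x c)).
have SX i : S 'X_i by rewrite /S mevalXU; apply: t_coord.
change (S p); rewrite (mpolyE p); elim/big_ind: _ => //.
  by rewrite -mpolyC0; apply: SC.
move=> m _; rewrite -mul_mpolyC; apply: (SM) => //.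
rewrite mpolyXE_id; elim/big_ind: _ => //; first by rewrite -mpolyC1; apply: SC.
move=> i _; elim: (m i) => [|k IHk]; first by rewrite expr0 -mpolyC1; apply: SC.
by rewrite exprS; apply: SM.
Qed.

(** A Laurent polynomial is a quotient of a polynomial by a monomial, and the
    value of the monomial is nonzero. *)
Lemma germ_residue f :
  eqmodr t (germ f) (local_ringC F x (laurent_eval x f)).
Proof.
have [[p m] ef] := laurent_numden f; simpl in ef.
have efp : f * laurent_poly 'X_[m] = laurent_poly p.
  by apply: val_inj; rewrite /= ef divfK // mpolyXF_neq0.
have := congr1 germ efp; rewrite rmorphM => e.
rewrite (laurent_evalE x ef) local_ringCM.
apply: (eqmodr_div e (germ_poly_residue _) (germ_poly_residue _)).
exact: local_ringCV (mevalX_neq0 x m).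
Qed.

(** If [t] divides the differences between the coordinates and their values, then
    it divides every element of the maximal ideal of the local ring. *)
Lemma local_ring_residue o : exists c y, o = local_ringC F x c + t * y.
Proof.
have [f [s [s0 e]]] := germ_frac o.
exists (laurent_eval x f / laurent_eval x s).
change (eqmodr t o (local_ringC F x (laurent_eval x f / laurent_eval x s))).
rewrite local_ringCM; apply: (eqmodr_div e (germ_residue _) (germ_residue _)).
exact: local_ringCV.
Qed.

End Germs.

(** * The order of vanishing of a difference of products *)

Section OrderOfVanishing.
Variables (K : numFieldType) (I : finType) (v : I -> K).

Definition lin_factor j : {poly K} := 1 + v j *: 'X.

Definition lin_prod (e : I -> nat) : {poly K} := \prod_j lin_factor j ^+ e j.

Let den : {poly K} := \prod_(j | v j != 0) lin_factor j.

Let num (e : I -> nat) : {poly K} :=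
  \sum_(j | v j != 0)
    (v j *+ e j) *: \prod_(k | (v k != 0) && (k != j)) lin_factor k.

Lemma lin_prod_horner e t : (lin_prod e).[t] = \prod_j (1 + v j * t) ^+ e j.
Proof.
rewrite /lin_prod horner_prod; apply: eq_bigr => j _.
by rewrite horner_exp !hornerE.
Qed.

Lemma lin_prod_horner0 e : (lin_prod e).[0] = 1.
Proof. by rewrite lin_prod_horner big1 // => j _; rewrite mulr0 addr0 expr1n. Qed.

(** The logarithmic derivative of a product of linear forms is the sum of the
    [v j *+ e j / (1 + v j X)]; the common denominator [den] has one factor per
    nonzero slope, so that the numerator [num] has degree less than the number
    of nonzero slopes, whatever the exponents. *)
Lemma lin_prod_logderiv e : den * (lin_prod e)^`() = lin_prod e * num e.
Proof.
rewrite /lin_prod /num [X in _ = _ * X]big_mkcond /=.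
pose logd F W := den * F^`() = F * W; rewrite -[_ = _]/(logd _ _).
apply: (big_ind2 logd) => [|F1 W1 F2 W2 e1 e2|j _].
- by rewrite /logd derivC mulr0 mulr0.
- by rewrite /logd derivM mulrDr mulrA e1 mulrCA e2; ring.
rewrite /logd; have d1 : (lin_factor j)^`() = (v j)%:P.
  by rewrite /lin_factor !derivE add0r alg_polyC.
rewrite deriv_exp d1; have [->|vj0] := eqVneq (v j) 0.
  by rewrite mul0r mul0rn !mulr0.
rewrite /den (bigD1 j) //=; set D := \prod_(k | _) _.
case: (e j) => [|k]; first by rewrite !mulr0n scale0r !mulr0.
rewrite /= exprS -[_ *: D]mul_polyC polyCMn.
rewrite -[(v j)%:P *+ _]mulr_natr -[in LHS]mulr_natr.
move: (lin_factor j ^+ k) (lin_factor j) (v j)%:P k.+1%:R D => {}F a b c D.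
by ring.
Qed.

(** Let [P] and [S] be the two products and [P - S = X^k Q]. The polynomial
    [P' S - P S'] vanishes at 0 to order exactly [k - 1], as the characteristic
    is zero. Up to [den], it is also [P * S] times the difference of the two
    numerators of logarithmic derivatives, whose degree is less than the number
    of nonzero slopes. So [k - 1] is less than this number. *)
Lemma order_lin_prodB p q : lin_prod p != lin_prod q ->
  exists k (Q : {poly K}), [/\ lin_prod p - lin_prod q = 'X^k * Q, Q.[0] != 0
    & (k <= #|[pred j | v j != 0%R]|)%N].
Proof.
set P := lin_prod p; set S := lin_prod q => neqPS.
have nz : P - S != 0 by rewrite subr_eq0.
have [k [Q nzQ0 eQ]] := multiplicity_XsubC (P - S) 0.
rewrite nz /= in nzQ0; rewrite subr0 mulrC in eQ.
exists k, Q; split=> //.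
case: k eQ => // k eQ.
(* Both sides are [den * (P' S - P S')]. *)
have eW : 'X^k * (den * (Q *+ k.+1 * S + 'X * (Q^`() * S - Q * S^`())))
    = P * S * (num p - num q).
  transitivity (den * ((P - S)^`() * S - (P - S) * S^`())).
    rewrite eQ derivM derivXn /= exprS.
    by rewrite -[Q *+ _]mulr_natr -[_ *+ k.+1]mulr_natr; ring.
  rewrite derivB; transitivity (den * P^`() * S - P * (den * S^`())); first by ring.
  by rewrite !lin_prod_logderiv -/P -/S; ring.
have den0 : den.[0] = 1.
  by rewrite /den horner_prod big1 // => j _; rewrite !hornerE.
have XW : 'X^k %| num p - num q.
  rewrite -(@Gauss_dvdpr _ _ (P * S)) -?eW ?dvdp_mulr //.
  rewrite coprimep_expl // -['X]subr0 -polyC0 coprimep_sym coprimep_XsubC.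
  by rewrite rootE hornerM !lin_prod_horner0 mul1r oner_eq0.
(* The cofactor of ['X^k] takes the value [k.+1 * Q.[0]] at 0. *)
have nzW : num p - num q != 0.
  apply: contraTneq nzQ0 => W0; rewrite W0 mulr0 in eW.
  move/eqP: eW; rewrite mulf_eq0 expf_eq0 polyX_eq0 andbF /= => /eqP e.
  have := congr1 (fun r => r.[0]) e.
  rewrite hornerM hornerD !hornerM hornerMn hornerX horner0 den0.
  rewrite lin_prod_horner0 mulr1 mul1r mul0r addr0.
  by move/eqP; rewrite mulrn_eq0 /= negbK.
have szW : (size (num p - num q)%R <= #|[pred j | v j != 0%R]|)%N.
  rewrite -sumrB (leq_trans (size_sum _ _ _)) //; apply/bigmax_leqP => j vj.
  rewrite -scalerBl (leq_trans (size_scale_leq _ _)) //.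
  rewrite (leq_trans (size_poly_prod_leq _ _)) //.
  set A := [pred k | (v k != 0) && (k != j)].
  have szA : (\sum_(k in A) size (lin_factor k) <= #|A| * 2)%N.
    rewrite -sum_nat_const; apply: leq_sum => i _.
    rewrite (leq_trans (size_polyD _ _)) // size_poly1 geq_max /=.
    by rewrite (leq_trans (size_scale_leq _ _)) ?size_polyX.
  have cA : #|[pred k | v k != 0]| = #|A|.+1.
    rewrite (cardD1 j) inE vj add1n; congr _.+1; apply: eq_card => i.
    by rewrite !inE andbC.
  rewrite cA leq_subLR; apply: (leq_ltn_trans szA).
  by rewrite muln2 -addnn addnS ltnS.
by apply: leq_trans szW; have := dvdp_leq nzW XW; rewrite size_polyXn.
Qed.

End OrderOfVanishing.

(** * Solutions close to one *)

Section NearOne.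
Variables (K : numFieldType) (I : finType).
Implicit Types (f g : (I -> K) -> K) (e : K).

(** Continuity at the point [(1, ..., 1)] of a function that takes the value 1 there. *)
Definition tends_to_one g := forall e, 0 < e ->
  exists2 d, 0 < d & forall w, (forall i, `|w i - 1| < d) -> `|g w - 1| < e.

Lemma pos_lower_bound (a b : K) :
  0 < a -> 0 < b -> exists2 c, 0 < c & (c <= a) && (c <= b).
Proof.
move=> a0 b0; have [ab|/ltW ba] := real_leP (gtr0_real a0) (gtr0_real b0).
  by exists a; rewrite ?lexx.
by exists b; rewrite ?lexx ?ba.
Qed.

Lemma tends_to_one_coord i : tends_to_one (fun w => w i).
Proof. by move=> e e0; exists e. Qed.

Lemma tends_to_one1 : tends_to_one (fun=> 1).
Proof. by move=> e e0; exists 1; rewrite ?ltr01 // => w _; rewrite subrr normr0. Qed.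

Lemma tends_to_one2 f g : tends_to_one f -> tends_to_one g ->
  forall e, 0 < e -> exists2 d, 0 < d & forall w, (forall i, `|w i - 1| < d) ->
    (`|f w - 1| < e) && (`|g w - 1| < e).
Proof.
move=> f1 g1 e e0; have [d1 d10 fd] := f1 e e0; have [d2 d20 gd] := g1 e e0.
have [d d0 /andP[dd1 dd2]] := pos_lower_bound d10 d20.
exists d => // w wd; rewrite fd ?gd // => i; exact: lt_le_trans (wd i) _.
Qed.

Lemma tends_to_oneM f g :
  tends_to_one f -> tends_to_one g -> tends_to_one (fun w => f w * g w).
Proof.
move=> f1 g1 e e0; have e30 : 0 < e / 3%:R by rewrite divr_gt0 ?ltr0n.
have [c c0 /andP[c1 ce]] := pos_lower_bound (@ltr01 K) e30.
have [d d0 fgd] := tends_to_one2 f1 g1 c0.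
exists d => // w /fgd /andP[fc gc].
have -> : f w * g w - 1 = (f w - 1) * (g w - 1) + (f w - 1) + (g w - 1) by ring.
have fg : `|(f w - 1) * (g w - 1)| < c.
  rewrite normrM (le_lt_trans _ gc) // ler_piMl //.
  by rewrite (le_trans (ltW fc)).
have -> : e = e / 3%:R + e / 3%:R + e / 3%:R by field.
apply: (le_lt_trans (ler_normD _ _)); apply: ltrD; last exact: lt_le_trans gc ce.
apply: (le_lt_trans (ler_normD _ _)).
by apply: ltrD; [exact: lt_le_trans fg ce | exact: lt_le_trans fc ce].
Qed.

Lemma tends_to_oneV f : tends_to_one f -> tends_to_one (fun w => (f w)^-1).
Proof.
move=> f1 e e0; have e20 : 0 < e / 2%:R by rewrite divr_gt0 ?ltr0n.
have h0 : 0 < 2%:R^-1 :> K by rewrite invr_gt0 ltr0n.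
have [c c0 /andP[c1 ce]] := pos_lower_bound h0 e20.
have [d d0 fd] := f1 _ c0; exists d => // w /fd fc.
have f_ge : 2%:R^-1 < `|f w|.
  rewrite -(ltrD2r 2%:R^-1); apply: (@le_lt_trans _ _ (`|f w| + `|f w - 1|)).
    have := ler_normD (f w) (1 - f w); rewrite subrKC normr1 distrC.
    by apply: le_trans; rewrite le_eqVlt; apply/orP; left; apply/eqP; field.
  by rewrite ltrD2l (lt_le_trans fc).
have fw0 : f w != 0 by rewrite -normr_gt0 (lt_trans h0).
have -> : (f w)^-1 - 1 = (1 - f w) / f w by rewrite mulrBl mul1r divff.
rewrite normrM normfV distrC ltr_pdivrMr ?normr_gt0 //.
apply: (lt_le_trans fc); apply: (le_trans ce); rewrite ler_pM2l //; exact: ltW.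
Qed.

Lemma tends_to_oneX f k : tends_to_one f -> tends_to_one (fun w => f w ^+ k).
Proof.
move=> f1; elim: k => [|k IHk] e e0.
  by have [d d0 fd] := tends_to_one1 e0; exists d.
have [d d0 fd] := tends_to_oneM f1 IHk e0; exists d => // w /fd.
by rewrite exprS.
Qed.

Lemma tends_to_oneXz f (z : int) :
  tends_to_one f -> tends_to_one (fun w => f w ^ z).
Proof.
by move=> f1; case: z => k; [exact: tends_to_oneX | exact/tends_to_oneV/tends_to_oneX].
Qed.

Lemma tends_to_one_prod (J : finType) (g : J -> (I -> K) -> K) :
  (forall j, tends_to_one (g j)) -> tends_to_one (fun w => \prod_j g j w).
Proof.
move=> g1; elim: (index_enum J) => [|j s IHs] e e0.
  have [d d0 fd] := tends_to_one1 e0; exists d => // w /fd.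
  by rewrite big_nil.
have [d d0 fd] := tends_to_oneM (g1 j) IHs e0; exists d => // w /fd.
by rewrite big_cons.
Qed.

Lemma tends_to_one_all (J : finType) (g : J -> (I -> K) -> K) e :
  (forall j, tends_to_one (g j)) -> 0 < e -> exists2 d, 0 < d &
    forall w, (forall i, `|w i - 1| < d) -> forall j, `|g j w - 1| < e.
Proof.
move=> g1 e0.
suff [d d0 dP] : exists2 d, 0 < d & forall w, (forall i, `|w i - 1| < d) ->
    forall j, j \in enum J -> `|g j w - 1| < e.
  by exists d => // w wd j; apply: dP; rewrite ?mem_enum.
elim: (enum J) => [|j s [d d0 IHs]]; first by exists 1.
have [d1 d10 gd] := g1 j e e0.
have [c c0 /andP[cd cd1]] := pos_lower_bound d0 d10.
exists c => // w wc i; rewrite inE => /predU1P[->|].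
  by apply: gd => k; apply: lt_le_trans (wc k) _.
by apply: IHs => k; apply: lt_le_trans (wc k) _.
Qed.

End NearOne.

(** The sum of the powers of a nontrivial [N]-th root of unity is zero, whereas
    each power [z ^+ i] is within [i * `|z - 1|] of 1. *)
Lemma unity_near_one (K : numFieldType) (z : K) N :
  (0 < N)%N -> z ^+ N = 1 -> `|z - 1| < N%:R^-1 -> z = 1.
Proof.
move=> N0 zN zlt; apply/eqP/negPn/negP => z1.
have nz : `|z| = 1.
  by apply/eqP; rewrite -(pexpr_eq1 N0 (normr_ge0 z)) -normrX zN normr1.
have sum0 : \sum_(i < N) z ^+ i = 0.
  apply/eqP; have /eqP := subrX1 z N; rewrite zN subrr eq_sym mulf_eq0.
  by rewrite subr_eq0 (negbTE z1).
have zk k : `|z ^+ k - 1| <= k%:R * `|z - 1|.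
  rewrite subrX1 normrM mulrC ler_wpM2r //.
  apply: (le_trans (ler_norm_sum _ _ _)).
  rewrite -[k in k%:R]card_ord -sum1_card natr_sum.
  by apply: ler_sum => i _; rewrite normrX nz expr1n.
have : \sum_(i < N) `|z ^+ i - 1| < \sum_(i < N) (1 : K).
  apply: ltr_sum => [|i _].
    by apply/hasP; exists (Ordinal N0) => //; rewrite mem_index_enum.
  apply: (le_lt_trans (zk i)).
  rewrite -[ltRHS](@mulfV _ N%:R) ?pnatr_eq0 -?lt0n //.
  apply: (@le_lt_trans _ _ (N%:R * `|z - 1|)).
    by rewrite ler_wpM2r // ler_nat ltnW.
  by rewrite ltr_pM2l ?ltr0n.
suff hle : \sum_(i < N) (1 : K) <= \sum_(i < N) `|z ^+ i - 1|.
  by move/(le_lt_trans hle); rewrite ltxx.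
have := ler_norm_sum (index_enum 'I_N) (fun i : 'I_N => z ^+ i - 1) xpredT.
by rewrite sumrB sum0 sub0r normrN ger0_norm // sumr_ge0.
Qed.

(** At 1, the factorization of [X^N - z] into linear factors gives [1 - z] as the
    product of the [1 - w] over the [N] roots [w], so the factor of least absolute
    value satisfies the bound. *)
Lemma root_near_one (K : numClosedFieldType) (z : K) N : (0 < N)%N ->
  exists w, w ^+ N = z /\ `|w - 1| ^+ N <= `|z - 1|.
Proof.
move=> N0; have [r er] := closed_field_poly_normal ('X^N - z%:P).
have mon : 'X^N - z%:P \is monic by rewrite monicXnsubC.
rewrite (monicP mon) scale1r in er.
have szr : size r = N.
  have := congr1 (fun p : {poly K} => size p) er.
  by rewrite size_XnsubC // size_prod_XsubC => -[].
have h1 : 1 - z = \prod_(w <- r) (1 - w).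
  have := congr1 (fun p => p.[1]) er.
  rewrite hornerD hornerN hornerXn hornerC expr1n horner_prod => ->.
  by apply: eq_bigr => w _; rewrite hornerXsubC.
have rootr w : w \in r -> w ^+ N = z.
  rewrite -root_prod_XsubC -er rootE hornerD hornerN hornerXn hornerC subr_eq0.
  by move/eqP.
have [/hasP[w wr wle]|none] := boolP (has (fun w => `|w - 1| ^+ N <= `|z - 1|) r).
  by exists w; split; [exact: rootr|].
have lt_w w : w \in r -> `|z - 1| < `|w - 1| ^+ N.
  move=> wr; rewrite real_ltNge ?rpredX ?normr_real //.
  by apply: contraNN none => wle; apply/hasP; exists w.
have : \prod_(w <- r) `|z - 1| < \prod_(w <- r) (`|w - 1| ^+ N).
  rewrite ![\prod_(_ <- _) _]big_seq_cond; apply: ltr_prod.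
    case: r szr {er h1 rootr none lt_w} => [/esym e|w r _]; first by rewrite e in N0.
    by rewrite /= inE eqxx.
  by move=> w /andP[wr _]; rewrite normr_ge0 lt_w.
rewrite prodrXl big_const_seq count_predT szr iter_mulr_1.
rewrite -[z - 1]opprB normrN h1 normr_prod.
by rewrite (eq_bigr _ (fun w _ => distrC 1 w)) ltxx.
Qed.

Definition posz_part (z : int) : nat := if z is Posz k then k else 0%N.
Definition negz_part (z : int) : nat := if z is Negz k then k.+1 else 0%N.

Lemma int_parts (z : int) : z = (posz_part z)%:Z - (negz_part z)%:Z.
Proof. by case: z => k; rewrite ?subr0 ?NegzE ?sub0r. Qed.

Lemma exprz_parts (F : fieldType) (u : F) z :
  u ^ z = u ^+ posz_part z / u ^+ negz_part z.
Proof. by case: z => k; rewrite /= ?expr0 ?divr1 ?div1r. Qed.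

Lemma exprz_sum (F : fieldType) (u : F) (I : finType) (f : I -> int) : u != 0 ->
  u ^ (\sum_i f i) = \prod_i u ^ f i.
Proof.
by move=> u0; apply: (big_morph (exprz u)) => // k l; rewrite expfzDr.
Qed.

Lemma exprz_prod (F : fieldType) (I : finType) (f : I -> F) (k : int) :
  (\prod_i f i) ^ k = \prod_i f i ^ k.
Proof.
by elim/big_rec2: _ => [|i y z _ <-]; rewrite ?expfzMl ?exp1rz.
Qed.

(** The points [y] with monomials [y ^ b k = 1 + v k * t] form a curve through
    [(1, ..., 1)], because the only condition on the values of the monomials
    (the relation [lam] between the exponents) holds identically in [t]. The
    coordinates of [y] are monomials in [N]-th roots [w j] of [1 + v j * t] taken
    close to 1: the matrix [l] inverts [b] up to the factor [N] and to
    multiples of [lam], and the monomial of exponent [lam] in the [w j], which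
    is an [N]-th root of unity by the relation, is 1 by proximity. *)
Lemma curve_near_one (K : numClosedFieldType) (I : finType) (n N : nat)
    (b : I -> 'rV[int]_n) (v : I -> K)
    (l : 'I_n -> I -> int) (lam alpha : I -> int) (e : K) :
    (0 < N)%N ->
    (forall k j, v j != 0 ->
      \sum_i l i j * b k 0 i = N%:Z *+ (k == j) + lam j * alpha k) ->
    lin_prod v (posz_part \o lam) = lin_prod v (negz_part \o lam) ->
    0 < e ->
  exists t : K, t != 0 /\ exists y : 'I_n -> K,
    [/\ forall i, y i != 0, forall i, `|y i - 1| < e
      & forall k, \prod_i y i ^ b k 0 i = 1 + v k * t].
Proof.
move=> N0 lP rel e0.
pose g i (w : I -> K) := \prod_j w j ^ l i j.
pose h (w : I -> K) := \prod_j w j ^ lam j.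
have g1 i : tends_to_one (g i).
  by apply: tends_to_one_prod => j; apply/tends_to_oneXz/tends_to_one_coord.
have h1 : tends_to_one h.
  by apply: tends_to_one_prod => j; apply/tends_to_oneXz/tends_to_one_coord.
have [d1 d10 gd1] := tends_to_one_all g1 e0.
have N0K : 0 < N%:R^-1 :> K by rewrite invr_gt0 ltr0n.
have [d2 d20 hd2] := h1 _ N0K.
have [d3 d30 /andP[d3d1 d3d2]] := pos_lower_bound d10 d20.
have [d d0 /andP[dd3 dle1]] := pos_lower_bound d30 (@ltr01 K).
pose S := 1 + \sum_j `|v j|.
have S0 : 0 < S by rewrite ltr_pwDl ?ltr01 // sumr_ge0.
pose t := d ^+ N / S.
have t0 : 0 < t by rewrite divr_gt0 ?exprn_gt0.
exists t; split; first by rewrite gt_eqF.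
have wP j : exists w, w ^+ N = 1 + v j * t /\ `|w - 1| ^+ N <= `|v j| * t.
  have [w [wN wle]] := root_near_one (1 + v j * t) N0; exists w; split=> //.
  by rewrite [1 + _]addrC addrK normrM (gtr0_norm t0) in wle.
pose w j := sval (cid (wP j)).
have wN j : w j ^+ N = 1 + v j * t by rewrite /w; case: cid => ? [].
have wle j : `|w j - 1| ^+ N <= `|v j| * t by rewrite /w; case: cid => ? [].
have wd j : `|w j - 1| < d.
  rewrite -(ltr_pXn2r N0) ?nnegrE ?normr_ge0 ?(ltW d0) //.
  apply: (le_lt_trans (wle j)); rewrite /t mulrCA -[ltRHS]mulr1.
  rewrite ltr_pM2l ?exprn_gt0 // ltr_pdivrMr // mul1r /S (bigD1 j) //=.
  by rewrite addrCA ltr_pwDr // ltr_pwDl ?ltr01 ?sumr_ge0.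
have w0 j : w j != 0.
  apply: contraTneq (lt_le_trans (wd j) dle1) => ->.
  by rewrite sub0r normrN normr1 ltxx.
(* The bound on the root makes it exactly 1 when [v j] vanishes; this covers
   the indices that the hypothesis on [l] leaves out. *)
have wv0 j : v j = 0 -> w j = 1.
  move=> vj0; have := wle j; rewrite vj0 normr0 mul0r => le0.
  apply/eqP; rewrite -subr_eq0 -normr_eq0 -[_ == 0]andTb -N0 -expf_eq0.
  by rewrite eq_le le0 exprn_ge0.
have hw : h w = 1.
  apply: (unity_near_one N0); last first.
    by apply: hd2 => j; rewrite (lt_le_trans (wd j)) ?(le_trans dd3).
  rewrite [h w ^+ N]exprnP /h exprz_prod.
  have u0 j : 1 + v j * t != 0 by rewrite -wN expf_neq0.
  transitivity (\prod_j ((1 + v j * t) ^+ posz_part (lam j)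
                         / (1 + v j * t) ^+ negz_part (lam j))).
    apply: eq_bigr => j _; rewrite -exprz_parts -wN exprnP !exprz_exp.
    by rewrite mulrC.
  rewrite prodf_div; have := congr1 (fun p => p.[t]) rel.
  rewrite !lin_prod_horner => ->; rewrite divff //.
  by apply/prodf_neq0 => j _; rewrite expf_neq0.
exists (fun i => g i w); split=> [i|i|k].
- by apply/prodf_neq0 => j _; rewrite expfz_neq0.
- by apply: gd1 => j; rewrite (lt_le_trans (wd j)) ?(le_trans dd3).
transitivity (\prod_j (w j ^+ (N * (k == j)) * (w j ^ lam j) ^ alpha k)).
  under eq_bigr => i _ do rewrite /g exprz_prod.
  rewrite exchange_big /=; apply: eq_bigr => j _.
  have [vj0|vj0] := eqVneq (v j) 0.
    rewrite wv0 // expr1n !exp1rz mulr1 big1 // => i _.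
    by rewrite !exp1rz.
  under eq_bigr => i _ do rewrite exprz_exp.
  rewrite -exprz_sum // lP // expfzDr // exprz_exp; congr (_ * _).
  by case: (k == j); rewrite ?muln1 ?muln0.
rewrite big_split /= -exprz_prod -/(h w) hw exp1rz mulr1.
rewrite (bigD1 k) //= eqxx muln1 wN big1 ?mulr1 // => j.
by rewrite eq_sym => /negbTE ->; rewrite muln0.
Qed.

(** * Linear relations between coefficients and between exponents *)

(** A plane is spanned by any of its nonzero vectors and any vector off its line. *)
Lemma rank2_plane (K : fieldType) m N (A : 'M[K]_(m, N)) (x : 'rV[K]_N) :
  \rank A = 2 -> x != 0 -> (x <= A)%MS ->
  (exists2 y : 'rV[K]_N, (y <= A)%MS & ~~ (y <= x)%MS) /\
  (forall y : 'rV[K]_N, (y <= A)%MS -> ~~ (y <= x)%MS -> (A <= col_mx x y)%MS).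
Proof.
move=> rA x0 xA; have rx : \rank x = 1 by rewrite rank_rV x0.
split.
  have /row_subPn[i nAi] : ~~ (A <= x)%MS.
    by apply/negP => /mxrankS; rewrite rA rx.
  by exists (row i A) => //; apply: row_sub.
move=> y yA nyx; have sA : (col_mx x y <= A)%MS by rewrite col_mx_sub xA yA.
rewrite -(geq_leqif (mxrank_leqif_sup sA)) rA.
apply: (@leq_trans (\rank x).+1); [by rewrite rx | apply: rank_ltmx].
rewrite /ltmx -addsmxE addsmxSl /=; apply: contra nyx.
by rewrite col_mx_sub => /andP[].
Qed.

(** The kernel of the coefficient matrix is a plane containing the vector of ones,
    so it is spanned by this vector and another one, [v], which can be normalized
    to take the values 0 and 1 at two indices [j0] and [j1]. A linear form vanishing
    on the plane is a combination of the rows of [c]; this applies to the form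
    which expresses the coordinate [j] of an element of the plane by its
    coordinates [j0] and [j1]. *)
Lemma kernel_through_ones (K : fieldType) n (c : 'M[K]_(n, n.+2)) :
  \rank c = n -> c *m const_mx 1 = 0 :> 'cV_n ->
  exists (j0 j1 : 'I_n.+2) (v : 'I_n.+2 -> K),
    [/\ v j0 = 0, v j1 = 1, forall i, \sum_j c i j * v j = 0
      & forall j, exists u : 'rV[K]_n,
          u *m c = delta_mx 0 j - (1 - v j) *: delta_mx 0 j0
                   - v j *: delta_mx 0 j1].
Proof.
move=> rc c1; pose A := kermx c^T; pose one : 'rV[K]_n.+2 := const_mx 1.
have rA : \rank A = 2 by rewrite mxrank_ker mxrank_tr rc -addn2 addKn.
have one0 : one != 0 by apply/rV0Pn; exists 0; rewrite mxE oner_eq0.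
have oneA : (one <= A)%MS.
  by rewrite sub_kermx -trmx_eq0 trmx_mul trmxK trmx_const c1.
have [[y yA ny] span] := rank2_plane rA one0 oneA.
have [j1 yj1] : exists j1, y 0 j1 != y 0 0.
  apply/existsP; apply: contraNT ny => /existsPn h.
  rewrite (_ : y = y 0 0 *: one) ?scalemx_sub //.
  by apply/rowP => j; rewrite !mxE mulr1; have := h j; rewrite negbK => /eqP.
pose v j := (y 0 j - y 0 0) / (y 0 j1 - y 0 0).
have d0 : y 0 j1 - y 0 0 != 0 by rewrite subr_eq0.
pose vr : 'rV[K]_n.+2 := \row_j v j.
have ev : vr = (y 0 j1 - y 0 0)^-1 *: (y - y 0 0 *: one).
  by apply/rowP => j; rewrite !mxE mulr1 mulrC.
have vA : (vr <= A)%MS by rewrite ev scalemx_sub // addmx_sub // -?scaleNr ?scalemx_sub.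
have nv : ~~ (vr <= one)%MS.
  apply: contra ny => h.
  rewrite (_ : y = (y 0 j1 - y 0 0) *: vr + y 0 0 *: one); last first.
    by rewrite ev scalerA mulfV // scale1r subrK.
  by rewrite addmx_sub ?scalemx_sub.
have sA := span _ vA nv.
exists 0, j1, v; split.
- by rewrite /v subrr mul0r.
- by rewrite /v mulfV.
- move=> i; have := vA; rewrite sub_kermx -trmx_eq0 trmx_mul trmxK => /eqP.
  move/matrixP/(_ i 0); rewrite !mxE => e; rewrite -[RHS]e.
  by apply: eq_bigr => j _; rewrite !mxE.
move=> j; set w := _ - _ - _.
suff /submxP[u ->] : (w <= c)%MS by exists u.
have cA : (c <= kermx A^T)%MS.
  by rewrite sub_kermx -trmx_eq0 trmx_mul trmxK mulmx_ker.
have kc : (kermx A^T <= c)%MS.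
  rewrite -(geq_leqif (mxrank_leqif_sup cA)) mxrank_ker mxrank_tr rA rc.
  by rewrite subn2.
apply: submx_trans kc; rewrite sub_kermx -trmx_eq0 trmx_mul trmxK.
have /submxP[D ->] := sA; rewrite -mulmxA mul_col_mx.
have xw (x : 'rV[K]_n.+2) :
    x *m w^T = const_mx (x 0 j - (1 - v j) * x 0 0 - v j * x 0 j1).
  rewrite /w !linearB !linearZ /= !trmx_delta -!colE.
  by apply/matrixP => k l; rewrite !ord1 !mxE; ring.
have -> : one *m w^T = 0.
  by rewrite xw; apply/matrixP => k l; rewrite !mxE; ring.
have -> : vr *m w^T = 0.
  by rewrite xw; apply/matrixP => k l; rewrite !mxE /v subrr mulfV //; ring.
by rewrite col_mx0 mulmx0.
Qed.

Lemma common_denominator (I : finType) (q : I -> rat) :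
  exists2 D : nat, (0 < D)%N & exists z : I -> int,
    forall i, (z i)%:~R = D%:R * q i.
Proof.
pose D := (\prod_i `|denq (q i)|)%N; exists D.
  by rewrite prodn_gt0 // => i; rewrite absz_gt0 denq_neq0.
suff zP i : exists z : int, z%:~R = D%:R * q i.
  by exists (fun i => sval (cid (zP i))) => i; case: cid.
have [E ->] : exists E : nat, D = (E * `|denq (q i)|)%N.
  by rewrite /D (bigD1 i) //= mulnC; eexists.
exists (E%:Z * numq (q i)); rewrite intrM natrM -mulrA; congr (_ * _).
rewrite -[X in _ = _ * X]divq_num_den mulrCA.
have -> : `|denq (q i)|%:R = (denq (q i))%:~R :> rat.
  by rewrite -[in RHS](gtz0_abs (denq_gt0 (q i))).
by rewrite mulfV ?mulr1 // intr_eq0 denq_neq0.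
Qed.

(** The matrix of the [b j] has a rational left inverse [L]. Its left kernel is a
    plane containing the basis vector of index [j0]; let [r] complete the latter to
    a basis of that plane. The product of the matrix by [L] is the identity modulo the
    kernel, that is, modulo multiples of [r] away from the column [j0]. A
    common denominator [D] makes all these numbers integral: the identity is
    multiplied by [D ^ 2], of which one factor goes to [r] and the other to the
    coefficients of its multiples. *)
Lemma lattice_relations n (b : 'I_n.+2 -> 'rV[int]_n) (j0 : 'I_n.+2) :
  b j0 = 0 ->
  (forall w : 'rV[rat]_n, w != 0 ->
     exists j, \sum_k (b j 0 k)%:~R * w 0 k != 0) ->
  exists (M : nat) (l : 'I_n -> 'I_n.+2 -> int) (lam alpha : 'I_n.+2 -> int),
    [/\ (0 < M)%N,
        forall i k, \sum_j l i j * b j 0 k = M%:Z *+ (i == k),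
        forall k, \sum_j lam j * b j 0 k = 0
      & forall k j, j != j0 ->
          \sum_i l i j * b k 0 i = M%:Z *+ (k == j) + lam j * alpha k].
Proof.
move=> bj0 span; pose B : 'M[rat]_(n.+2, n) := \matrix_(j, k) (b j 0 k)%:~R.
have rB : \rank B = n.
  apply/eqP; rewrite -mxrank_tr -/(row_free B^T) -kermx_eq0; apply/negPn/negP.
  move/rowV0Pn => [w wB /span[j]]; move: wB; rewrite sub_kermx => /eqP.
  move/rowP/(_ j); rewrite !mxE => e /eqP[]; rewrite -[RHS]e.
  by apply: eq_bigr => k _; rewrite !mxE mulrC.
have [L LB] : exists L, L *m B = 1%:M.
  by exists (pinvmx B); rewrite mulVpmx // /row_full rB.
pose A := kermx B; have rA : \rank A = 2 by rewrite mxrank_ker rB -addn2 addKn.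
pose e0 : 'rV[rat]_n.+2 := delta_mx 0 j0.
have e00 : e0 != 0 by apply/rV0Pn; exists j0; rewrite mxE !eqxx oner_eq0.
have e0A : (e0 <= A)%MS.
  rewrite sub_kermx -rowE; apply/eqP/rowP => k.
  by rewrite !mxE bj0 mxE.
have [[r rA' nr] spanA] := rank2_plane rA e00 e0A.
have r0 : r *m B = 0 by apply/eqP; rewrite -sub_kermx.
have : (B *m L - 1%:M <= A)%MS.
  by rewrite sub_kermx mulmxBl mul1mx -mulmxA LB mulmx1 subrr.
move/submx_trans/(_ (spanA _ rA' nr)) => /submxP[W eW].
pose al k : rat := W k (rshift 1 0).
have eBL k j : j != j0 -> (B *m L) k j = (k == j)%:R + r 0 j * al k.
  move=> jj0; have /matrixP/(_ k j) := eW.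
  rewrite !mxE big_split_ord /= !big_ord1 !(col_mxEu, col_mxEd).
  rewrite [e0 _ _]mxE (negbTE jj0) andbF mulr0 add0r => /eqP.
  by rewrite subr_eq => /eqP ->; rewrite addrC [al k * _]mulrC.
pose q (s : 'I_n * 'I_n.+2 + ('I_n.+2 + 'I_n.+2)) : rat :=
  match s with
  | inl ij => L ij.1 ij.2 | inr (inl j) => r 0 j | inr (inr k) => al k
  end.
have [D D0 [z zP]] := common_denominator q.
exists (D ^ 2)%N, (fun i j => D%:Z * z (inl (i, j))), (fun j => z (inr (inl j))),
  (fun k => z (inr (inr k))).
have intq (x1 x2 : int) : x1%:~R = x2%:~R :> rat -> x1 = x2 by move/intr_inj.
split; first by rewrite expn_gt0 D0.
- move=> i k; apply: intq; have /matrixP/(_ i k) := LB; rewrite !mxE => e.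
  rewrite rmorphMn /= -mulr_natr -e rmorph_sum mulr_sumr; apply: eq_bigr => j _.
  by rewrite !rmorphM /= zP !mxE /= -!pmulrn; ring.
- move=> k; apply: intq; have /rowP/(_ k) := r0; rewrite !mxE => e.
  transitivity (D%:R * \sum_j r 0 j * B j k); last by rewrite e mulr0.
  rewrite rmorph_sum mulr_sumr; apply: eq_bigr => j _.
  by rewrite rmorphM /= zP !mxE /=; ring.
move=> k j jj0; apply: intq; have := eBL k j jj0; rewrite mxE => e.
rewrite rmorphD rmorphM rmorphMn /= !zP /= -mulr_natr.
transitivity ((D ^ 2)%N%:R * ((k == j)%:R + r 0 j * al k)); last first.
  by rewrite -!pmulrn; ring.
rewrite -e rmorph_sum mulr_sumr; apply: eq_bigr => i _.
by rewrite !rmorphM /= zP !mxE /= -!pmulrn; ring.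
Qed.

(** * The uniformizer of the local ring at one *)

Section LaurentMonomials.
Variables (K : fieldType) (n : nat).

Lemma laurentX0 : laurentX K (0 : 'rV[int]_n) = 1.
Proof. by apply: val_inj; rewrite /= big1 // => i _; rewrite mxE expr0z. Qed.

Lemma laurentXD (a b : 'rV[int]_n) :
  laurentX K (a + b) = laurentX K a * laurentX K b.
Proof.
apply: val_inj; rewrite /= -big_split; apply: eq_bigr => i _ /=.
by rewrite mxE expfzDr // mpolyXF_neq0.
Qed.

Lemma laurentXN (a : 'rV[int]_n) : laurentX K (- a) * laurentX K a = 1.
Proof. by rewrite -laurentXD addNr laurentX0. Qed.

Lemma laurentXMn (a : 'rV[int]_n) k : laurentX K (a *+ k) = laurentX K a ^+ k.
Proof.
by elim: k => [|k IHk]; rewrite ?mulr0n ?laurentX0 // mulrS laurentXD IHk exprS.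
Qed.

Lemma laurentX_sum (I : finType) (f : I -> 'rV[int]_n) :
  laurentX K (\sum_i f i) = \prod_i laurentX K (f i).
Proof. exact: (big_morph _ laurentXD laurentX0). Qed.

Lemma laurentX_delta (i : 'I_n) :
  laurentX K (delta_mx 0 i) = laurent_poly 'X_i.
Proof.
apply: val_inj; rewrite /= (bigD1 i) //= big1 ?mulr1 => [|j ji].
  by rewrite mxE !eqxx expr1z.
by rewrite mxE (negbTE ji) andbF expr0z.
Qed.

Lemma laurent_eval1X a : laurent_eval (torus1 K n) (laurentX K a) = 1.
Proof. by rewrite laurent_evalX big1 // => i _; rewrite mxE exp1rz. Qed.

Lemma laurent_poly_inj : injective (@laurent_poly K n).
Proof. by move=> p q /(congr1 val)/eqP; rewrite /= tofrac_eq => /eqP. Qed.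

(** The product of the denominators is a common one, and it vanishes nowhere on
    the torus. *)
Lemma clear_denominators (I : finType) (g : I -> laurent K n) (x : torus K n) :
  exists M, M.@[(x : 'rV_n) 0] != 0 /\
    exists p : I -> {mpoly K[n]}, forall i, g i * laurent_poly M = laurent_poly (p i).
Proof.
pose den i := (projT1 (cid (laurent_numden (g i)))).2.
pose num i := (projT1 (cid (laurent_numden (g i)))).1.
have gE i : g i * laurent_poly 'X_[den i] = laurent_poly (num i).
  apply: val_inj; rewrite /den /num; case: cid => pm /= ->.
  by rewrite divfK // mpolyXF_neq0.
exists (\prod_i 'X_[den i]); split.
  by rewrite rmorph_prod; apply/prodf_neq0 => i _; apply: mevalX_neq0.
exists (fun i => num i * \prod_(j | j != i) 'X_[den j]) => i.
by rewrite (bigD1 i) //= rmorphM mulrA gE -rmorphM.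
Qed.

End LaurentMonomials.

(** The morphism [phi] stands for the passage to the local ring of a system at
    [(1, ..., 1)]; the image of [T] will be a generator of its maximal ideal. *)
Section Uniformizer.
Variables (K : numFieldType) (n : nat).
Local Notation pt := (torus1 K n).
Variables (O : comPzRingType) (phi : {rmorphism laurent K n -> O}).
Hypothesis phi_unit : forall u, laurent_eval pt u != 0 -> exists w, phi u * w = 1.
Variables (I : finType) (b : I -> 'rV[int]_n) (v : I -> K) (T : laurent K n).
Hypothesis T0 : laurent_eval pt T = 0.
Hypothesis bT : forall j,
  phi (laurentX K (b j)) = phi (1 + laurentC K n (v j) * T).

Definition monomial_eqmod1 (m : 'rV[int]_n) :=
  eqmodr (phi T) (phi (laurentX K m)) 1.

Lemma monomial_eqmod1_gen j : monomial_eqmod1 (b j).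
Proof.
exists (phi (laurentC K n (v j))); rewrite bT rmorphD rmorph1 rmorphM.
by rewrite [phi T * _]mulrC.
Qed.

Lemma monomial_eqmod1_0 : monomial_eqmod1 0.
Proof. by rewrite /monomial_eqmod1 laurentX0 rmorph1; exact: eqmodr_refl. Qed.

Lemma monomial_eqmod1D m1 m2 :
  monomial_eqmod1 m1 -> monomial_eqmod1 m2 -> monomial_eqmod1 (m1 + m2).
Proof.
move=> h1 h2; rewrite /monomial_eqmod1 laurentXD rmorphM.
by have := eqmodrM h1 h2; rewrite mulr1.
Qed.

Lemma monomial_eqmod1N m : monomial_eqmod1 m -> monomial_eqmod1 (- m).
Proof.
move=> h; have e : phi (laurentX K (- m)) * phi (laurentX K m) = phi 1.
  by rewrite -rmorphM laurentXN.
rewrite rmorph1 in e.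
have := eqmodr_div e h (eqmodr_refl _ _) (mulr1 1).
by rewrite mulr1.
Qed.

Lemma monomial_eqmod1Mz m (k : int) : monomial_eqmod1 m -> monomial_eqmod1 (m *~ k).
Proof.
move=> h; have hn l : monomial_eqmod1 (m *+ l).
  elim: l => [|l IHl]; first exact: monomial_eqmod1_0.
  by rewrite mulrS; apply: monomial_eqmod1D.
by case: k => l; [exact: hn | rewrite NegzE mulrNz; apply/monomial_eqmod1N/hn].
Qed.

Lemma monomial_eqmod1_sum (J : finType) (f : J -> 'rV[int]_n) :
  (forall j, monomial_eqmod1 (f j)) -> monomial_eqmod1 (\sum_j f j).
Proof.
move=> h; elim/big_ind: _ => // [|m1 m2]; first exact: monomial_eqmod1_0.
exact: monomial_eqmod1D.
Qed.

(** [x^M - 1] is [x - 1] times a sum of [M] powers of [x], and this sum has the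
    nonzero value [M] at the point, hence is a unit. *)
Lemma monomial_eqmod1_root (M : nat) (m : 'rV[int]_n) :
  (0 < M)%N -> monomial_eqmod1 (m *+ M) -> monomial_eqmod1 m.
Proof.
move=> M0 h; set xi := laurentX K m.
pose s := \sum_(i < M) xi ^+ i.
have s0 : laurent_eval pt s != 0.
  rewrite rmorph_sum (eq_bigr (fun=> 1)) => [|i _].
    by rewrite sumr_const card_ord pnatr_eq0 -lt0n.
  by rewrite rmorphXn /= laurent_eval1X expr1n.
have [w ew] := phi_unit s0.
have e : phi (xi - 1) * phi s = phi (xi ^+ M - 1) by rewrite -rmorphM -subrX1.
have h1 : eqmodr (phi T) (phi (xi ^+ M - 1)) 0.
  have [y ey] := h; exists y; rewrite rmorphB rmorph1 -laurentXMn ey.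
  by rewrite addrAC subrr.
have h2 := eqmodr_div e (eqmodr_refl _ _) h1 ew.
have [y ey] := h2; exists y.
rewrite -[laurentX K m](subrK 1) rmorphD rmorph1 -/xi ey.
by rewrite mul0r add0r addrC.
Qed.

(** The [b j] generate a sublattice of finite index: the power [M] of each
    coordinate is a monomial in the [laurentX K (b j)], so that it is 1 modulo [T],
    and [monomial_eqmod1_root] applies. *)
Lemma coordinates_eqmod1 (M : nat) (l : 'I_n -> I -> int) :
  (0 < M)%N ->
  (forall i k, \sum_j l i j * b j 0 k = M%:Z *+ (i == k)) ->
  forall i, eqmodr (phi T) (phi (laurent_poly 'X_i)) 1.
Proof.
move=> M0 lb i; rewrite -laurentX_delta.
apply: (monomial_eqmod1_root M0).
have -> : delta_mx 0 i *+ M = \sum_j b j *~ l i j :> 'rV[int]_n.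
  apply/rowP => k; rewrite summxE mulmxnE mxE eqxx eq_sym /=.
  rewrite -[LHS]mulr_natl; transitivity (M%:Z *+ (i == k)).
    by rewrite mulr_natr natz.
  rewrite -lb; apply: eq_bigr => j _.
  by rewrite -scaler_int mxE intz.
by apply: monomial_eqmod1_sum => j; apply/monomial_eqmod1Mz/monomial_eqmod1_gen.
Qed.

Definition eval_at (p : {poly K}) : laurent K n := (map_poly (laurentC K n) p).[T].

Lemma eval_atM p q : eval_at (p * q) = eval_at p * eval_at q.
Proof. by rewrite /eval_at rmorphM hornerM. Qed.

Lemma eval_atB p q : eval_at (p - q) = eval_at p - eval_at q.
Proof. by rewrite /eval_at rmorphB hornerD hornerN. Qed.

Lemma eval_atXn k : eval_at 'X^k = T ^+ k.
Proof. by rewrite /eval_at map_polyXn hornerXn. Qed.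

Lemma laurent_eval_at p : laurent_eval pt (eval_at p) = p.[0].
Proof.
rewrite /eval_at -horner_map /= T0 -map_poly_comp map_poly_id // => c _ /=.
exact: laurent_evalC.
Qed.

Lemma image_lin_prod e :
  phi (eval_at (lin_prod v e)) = phi (\prod_j laurentX K (b j) ^+ e j).
Proof.
have -> : eval_at (lin_prod v e) = \prod_j (1 + laurentC K n (v j) * T) ^+ e j.
  rewrite /eval_at /lin_prod rmorph_prod horner_prod; apply: eq_bigr => j _.
  rewrite rmorphXn horner_exp /lin_factor rmorphD rmorph1 /= map_polyZ map_polyX.
  by rewrite hornerD hornerC hornerZ hornerX.
rewrite (rmorph_prod phi) (rmorph_prod phi); apply: eq_bigr => j _.
by rewrite (rmorphXn phi) (rmorphXn phi) -bT.
Qed.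

(** The relation [lam] between the exponents becomes the equation
    [lin_prod v lam^+ = lin_prod v lam^-] at [T]. Its difference is [T ^+ k] times
    a unit, with [k] bounded by [order_lin_prodB]. *)
Lemma uniformizer_nilpotent (lam : I -> int) :
  (forall k, \sum_j lam j * b j 0 k = 0) ->
  lin_prod v (posz_part \o lam) != lin_prod v (negz_part \o lam) ->
  exists2 k : nat, phi T ^+ k = 0 & (k <= #|[pred j | v j != 0%R]|)%N.
Proof.
move=> rel neq.
have [k [Q [eQ Q0 kle]]] := order_lin_prodB neq; exists k => //.
have Xrel : \prod_j laurentX K (b j) ^+ (posz_part \o lam) j
          = \prod_j laurentX K (b j) ^+ (negz_part \o lam) j.
  under eq_bigr do rewrite -laurentXMn.
  under [RHS]eq_bigr do rewrite -laurentXMn.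
  rewrite -!laurentX_sum; congr laurentX; apply/rowP => i.
  apply/eqP; rewrite -subr_eq0 !summxE -sumrB -[X in _ == X](rel i).
  apply/eqP; apply: eq_bigr => j _; rewrite !mulmxnE [in RHS](int_parts (lam j)).
  by rewrite mulrBl -[(posz_part _)%:Z]natz -[(negz_part _)%:Z]natz !mulr_natl.
have e : phi (eval_at 'X^k * eval_at Q) = phi 0.
  rewrite -eval_atM -eQ eval_atB rmorphB !image_lin_prod.
  by rewrite Xrel subrr rmorph0.
rewrite eval_atXn rmorph0 rmorphM rmorphXn in e.
have [w ew] : exists w, phi (eval_at Q) * w = 1.
  by apply: phi_unit; rewrite laurent_eval_at.
by rewrite -[LHS]mulr1 -ew mulrA e mul0r.
Qed.

End Uniformizer.

Lemma multiplicity_uniformizer (K : fieldType) n r (F : 'I_r -> laurent K n)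
    (t : local_ring F (torus1 K n)) k :
  (forall i, eqmodr t (germ F (torus1 K n) (laurent_poly 'X_i)) 1) ->
  t ^+ k = 0 ->
  exists d, [/\ multiplicity F (torus1 K n) d, (d <= k)%N & t ^+ d = 0].
Proof.
move=> coord tk0.
have exk : exists k, t ^+ k == 0 by exists k; rewrite tk0.
case: (ex_minnP exk) => d /eqP td0 dmin.
have tn0 i : (i < d)%N -> t ^+ i != 0.
  by move=> id; apply/negP => /dmin; rewrite leqNgt id.
exists d; split=> //; last by apply: dmin; rewrite tk0.
apply: has_dim_uniformizer td0 tn0; apply: local_ring_residue => i.
by rewrite [_ 0 i]mxE local_ringC1.
Qed.

(** * The upper bound *)

(** A rational linear form constant on the support would define an affine
    hyperplane over the real numbers. *)
Lemma rational_form_nonconstant (R : realType) n N (a : 'I_N -> 'rV[int]_n)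
    (j0 : 'I_N) :
  ~ in_affine_hyperplane R a ->
  forall w : 'rV[rat]_n, w != 0 ->
    exists j, \sum_k ((a j - a j0) 0 k)%:~R * w 0 k != 0.
Proof.
move=> na w w0; apply/existsP; apply: contra_notT na => /existsPn h.
exists (map_mx ratr w), (\sum_k ratr (w 0 k) * (a j0 0 k)%:~R); split.
  by rewrite map_mx_eq0.
move=> j; apply/eqP; rewrite -subr_eq0 -sumrB.
have := h j; rewrite negbK => /eqP /(congr1 (@ratr R)).
rewrite rmorph0 => e; apply/eqP; rewrite -[RHS]e rmorph_sum; apply: eq_bigr => k _.
by rewrite !mxE rmorphM /= ratr_int rmorphB /= -mulrBr mulrC.
Qed.

Lemma translated_relation (B : comPzRingType) (x y y0 y1 c : B) : x * y0 = 1 ->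
  y * x - (1 + c * (y1 * x - 1)) = x * (y - (1 - c) * y0 - c * y1).
Proof. by move=> xy; rewrite -{1}xy; ring: xy. Qed.

(** After division by the monomial of exponent [a j0], the equations say that
    the monomials are the linear forms [1 + v j * T], where [T] is one of them
    minus 1. If the two sides of the relation between these forms agreed
    identically, [curve_near_one] would produce other solutions arbitrarily
    close to [(1, ..., 1)]. *)
Lemma multiplicity_bound (R : realType) n (a : 'I_n.+2 -> 'rV[int]_n)
    (c : 'M[R[i]]_(n, n.+2)) :
  ~ in_affine_hyperplane R a -> \rank c = n ->
  isolated_solution a c (torus1 R[i] n) ->
  exists2 d : nat,
    multiplicity (system a c) (torus1 R[i] n) d & (d <= n.+1)%N.
Proof.
move=> na rc [sol [e e0 iso]].
have c1 : c *m const_mx 1 = 0 :> 'cV_n.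
  apply/colP => i; rewrite !mxE -[RHS](sol i); apply: eq_bigr => j _.
  by rewrite mxE big1 // => k _; rewrite mxE exp1rz.
have [j0 [j1 [v [v0 v1 cv span]]]] := kernel_through_ones rc c1.
pose b j := a j - a j0.
have b0 : b j0 = 0 by rewrite /b subrr.
have [M [l [lam [al [M0 lb rel lal]]]]] :=
  lattice_relations b0 (rational_form_nonconstant j0 na).
pose T : laurent R[i] n := laurentX _ (b j1) - 1.
have T0 : laurent_eval (torus1 R[i] n) T = 0.
  by rewrite rmorphB rmorph1 /= laurent_eval1X subrr.
have bT j : germ (system a c) (torus1 R[i] n) (laurentX _ (b j))
    = germ (system a c) (torus1 R[i] n) (1 + laurentC _ n (v j) * T).
  apply: germ_congr; apply/gen_idealP; have [u eu] := span j.
  exists (fun i => laurentX _ (- a j0) * laurentC _ n (u 0 i)).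
  (* The equation with coefficients [w] on the support. *)
  pose S (w : 'rV[R[i]]_n.+2) := \sum_k laurentC _ n (w 0 k) * laurentX _ (a k).
  have SB w1 w2 : S (w1 - w2) = S w1 - S w2.
    rewrite /S -sumrB; apply: eq_bigr => k _.
    by rewrite !mxE rmorphB mulrBl.
  have SZ z w : S (z *: w) = laurentC _ n z * S w.
    by rewrite /S mulr_sumr; apply: eq_bigr => k _; rewrite mxE rmorphM mulrA.
  have Sd k : S (delta_mx 0 k) = laurentX _ (a k).
    rewrite /S (bigD1 k) //= mxE !eqxx rmorph1 mul1r big1 ?addr0 // => m mk.
    by rewrite mxE (negbTE mk) andbF rmorph0 mul0r.
  have -> : \sum_i laurentX _ (- a j0) * laurentC _ n (u 0 i) * system a c i
      = laurentX _ (- a j0) * S (u *m c).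
    transitivity (laurentX _ (- a j0) * \sum_i laurentC _ n (u 0 i) * system a c i).
      by rewrite mulr_sumr; apply: eq_bigr => i _; rewrite mulrA.
    congr (_ * _); rewrite /S /system.
    under eq_bigr => i _ do rewrite mulr_sumr.
    rewrite exchange_big; apply: eq_bigr => k _.
    rewrite mxE (rmorph_sum (laurentC R[i] n)) mulr_suml; apply: eq_bigr => i _.
    by rewrite (rmorphM (laurentC R[i] n)) mulrA.
  rewrite eu !SB !SZ !Sd rmorphB rmorph1 /T !laurentXD.
  set X := laurentX _ (- _); set Y0 := laurentX _ (a j0).
  have XY : X * Y0 = 1 by exact: laurentXN.
  exact: translated_relation XY.
have neq : lin_prod v (posz_part \o lam) != lin_prod v (negz_part \o lam).
  apply/eqP => eqlin.
  have eC0 : 0 < e%:C%C by rewrite ltcR.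
  have [|t [t0 [y [y0 y1 yb]]]] :=
    @curve_near_one _ _ _ _ b v l lam al _ M0 _ eqlin eC0.
    by move=> k j vj; apply: lal; apply: contraNneq vj => ->; rewrite v0.
  have yP : [forall i, (\row_i y i) 0 i != 0].
    by apply/forallP => i; rewrite mxE.
  have ysol : is_solution a c (Torus yP).
    move=> i; transitivity ((\prod_k y k ^ a j0 0 k) *
       (\sum_j c i j * 1 + t * \sum_j c i j * v j)).
      rewrite mulr_sumr -big_split mulr_sumr /=; apply: eq_bigr => j _.
      have -> : c i j * 1 + t * (c i j * v j) = c i j * (1 + v j * t) by ring.
      rewrite -yb mulrCA -big_split /=; congr (_ * _); apply: eq_bigr => k _.
      rewrite !mxE -expfzDr //; congr (_ ^ _); ring.
    rewrite cv mulr0 addr0.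
    have /colP/(_ i) := c1; rewrite !mxE => ei.
    rewrite (eq_bigr (fun j => c i j * const_mx 1 j (0 : 'I_1))).
      by rewrite ei mulr0.
    by move=> j _; rewrite mxE.
  have eY : Torus yP = torus1 R[i] n.
    by apply: iso ysol => k; rewrite !mxE.
  have yi1 i : y i = 1.
    have := congr1 (fun x : torus R[i] n => (x : 'rV[R[i]]_n) 0 i) eY.
    by rewrite /= !mxE.
  have := yb j1; rewrite big1 => [|i _]; last by rewrite yi1 exp1rz.
  by rewrite v1 mul1r => /esym/eqP; rewrite -subr_eq0 addrC addKr (negbTE t0).
have unit := @germ_unit _ _ _ (system a c) (torus1 R[i] n).
have [k Tk0 kle] := uniformizer_nilpotent unit T0 bT rel neq.
have coord := coordinates_eqmod1 unit bT M0 lb.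
have [d [dim dk _]] := multiplicity_uniformizer coord Tk0.
exists d => //; apply: (leq_trans dk); apply: (leq_trans kle).
have : (#|[pred j | v j != 0%R]| < #|'I_n.+2|)%N.
  apply: proper_card; apply/properP; split; first exact/subsetP.
  by exists j0 => //; rewrite inE v0 eqxx.
by rewrite card_ord ltnS.
Qed.

(** * A system of multiplicity n + 1 *)

(** The polynomial [1 + X + ... + X^n] has constant term 1, so it is the product of
    the [1 - X / w] over its roots [w]. *)
Lemma lin_prod_geometric (K : numClosedFieldType) n :
  exists v : 'I_n -> K, (1 - 'X) * lin_prod v (fun=> 1%N) = 1 - 'X^(n.+1).
Proof.
pose p : {poly K} := \poly_(i < n.+1) 1.
have pE : (1 - 'X) * p = 1 - 'X^(n.+1).
  rewrite /p poly_def -[RHS]opprB subrX1 -mulNr opprB; congr (_ * _).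
  by apply: eq_bigr => i _; rewrite scale1r.
have szp : size p = n.+1 by rewrite size_poly_eq // oner_eq0.
have lp : lead_coef p = 1 by rewrite lead_coefE szp coef_poly ltnSn.
have [r er] := closed_field_poly_normal p; rewrite lp scale1r in er.
have szr : size r = n by have := szp; rewrite er size_prod_XsubC => -[].
have p0 : p.[0] = 1 by rewrite horner_coef0 coef_poly.
have p0r : \prod_(w <- r) (- w) = 1.
  apply: etrans p0; rewrite er horner_prod; apply: eq_bigr => w _.
  by rewrite hornerXsubC sub0r.
have r0 w : w \in r -> w != 0.
  rewrite -root_prod_XsubC -er; apply: contraTneq => ->.
  by rewrite rootE p0 oner_eq0.
exists (fun j => - (nth 0 r j)^-1); rewrite -pE; congr (_ * _).
transitivity (\prod_(w <- r) (1 - w^-1 *: 'X)).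
  rewrite (big_nth 0) szr big_mkord /lin_prod; apply: eq_bigr => j _.
  by rewrite expr1 /lin_factor scaleNr.
rewrite er.
transitivity ((\prod_(w <- r) (- w)%:P) * \prod_(w <- r) (1 - w^-1 *: 'X)).
  by rewrite -rmorph_prod /= p0r mul1r.
rewrite -big_split /= !big_seq.
apply: eq_bigr => w /r0 w0; rewrite mulrBr mulr1 -mul_polyC mulrA -polyCM.
by rewrite mulNr mulfV // polyCN polyCN polyC1; ring.
Qed.

Lemma extremal_identity (B : comPzRingType) (x y c : B) :
  - (1 + c) * 1 + (c * y + (1 * x + 0)) = x - (1 + c * (1 - y)).
Proof. by ring. Qed.

Lemma expr_eq0_le (B : pzSemiRingType) (t : B) d k :
  (d <= k)%N -> t ^+ d = 0 -> t ^+ k = 0.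
Proof. by move=> le_dk td0; rewrite -(subnK le_dk) exprD td0 mulr0. Qed.

Lemma mul_complement (B : comPzRingType) (t y : B) : (1 - t) * y = 1 -> y * t = y - 1.
Proof. by move=> e; rewrite -[X in _ - X]e; ring. Qed.

Lemma mul_equation (B : comPzRingType) (x y c t : B) :
  y * (x - (1 + c * t)) = y * x - y - c * (y * t).
Proof. by ring. Qed.

Lemma clear_left (B : comPzRingType) (u m y t : B) k :
  u * m * (y * t) ^+ k * y = u * t ^+ k * (m * y ^+ k.+1).
Proof. by rewrite exprMn exprS; ring. Qed.

Lemma clear_right (B : comPzRingType) (g m y f : B) k :
  g * m * (y * f) * y ^+ k = g * f * (m * y ^+ k.+1).
Proof. by rewrite exprS; ring. Qed.

Section ExtremalSystem.
Variables (R : realType) (n : nat).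
Hypothesis n_gt0 : (0 < n)%N.
Local Notation K := R[i].
Local Notation pt := (torus1 K n).
Variable v : 'I_n -> K.
Hypothesis v_geom : (1 - 'X) * lin_prod v (fun=> 1%N) = 1 - 'X^(n.+1).

(** The exponents of the monomials [1, x_1, ..., x_n, (x_1 ... x_n)^-1]. *)
Definition extremal_support (j : 'I_n.+2) : 'rV[int]_n :=
  \row_k if (j : nat) == n.+1 then -1 else ((j : nat) == k.+1)%:Z.

(** The equations [x_i = 1 + v_i T] for [T = 1 - (x_1 ... x_n)^-1]; by the choice
    of [v], the product of the right-hand sides is the geometric sum, so that
    [1 - T^(n+1) = (1 - T) x_1 ... x_n = 1]. *)
Definition extremal_coef : 'M[K]_(n, n.+2) :=
  \matrix_(i, j) if (j : nat) == 0%N then - (1 + v i)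
                 else if (j : nat) == n.+1 then v i else ((j : nat) == i.+1)%:R.

Local Notation a := extremal_support.
Local Notation c := extremal_coef.

Lemma extremal_support_first : a 0 = 0.
Proof. by apply/rowP => k; rewrite !mxE. Qed.

Lemma extremal_support_mid (i : 'I_n) (j : 'I_n.+2) :
  (j : nat) = i.+1 -> a j = delta_mx 0 i.
Proof.
move=> ej; apply/rowP => k; rewrite !mxE ej eqxx eqSS (ltn_eqF (ltn_ord i)) /=.
by rewrite eqSS eq_sym natz.
Qed.

Lemma extremal_support_last : a ord_max = const_mx (-1).
Proof. by apply/rowP => k; rewrite !mxE eqxx. Qed.

Lemma extremal_support_inj : injective a.
Proof.
move=> j1 j2 e; apply/val_inj => /=.
have h k : (k < n)%N -> (if (j1 : nat) == n.+1 then -1 else ((j1 : nat) == k.+1)%:Z)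
    = (if (j2 : nat) == n.+1 then -1 else ((j2 : nat) == k.+1)%:Z) :> int.
  by move=> kn; have /rowP/(_ (Ordinal kn)) := e; rewrite !mxE.
have := h 0%N n_gt0; have := h (j1 : nat).-1; have := h (j2 : nat).-1.
have := ltn_ord j1; have := ltn_ord j2.
move: (j1 : nat) (j2 : nat) n_gt0 {h e} => x y; clear.
have [->|nx] := eqVneq x n.+1; have [->|ny] := eqVneq y n.+1 => //; lia.
Qed.

Lemma extremal_support_spans : ~ in_affine_hyperplane R a.
Proof.
move=> [w [b [w0 wb]]]; case/negP: w0; apply/eqP/rowP => k.
have b0 : b = 0.
  rewrite -(wb 0) big1 // => i _; by rewrite extremal_support_first mxE mulr0.
have kn : (k.+1 < n.+2)%N by rewrite ltnS ltnW // ltnS.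
rewrite mxE -b0 -(wb (Ordinal kn)) (@extremal_support_mid k) //.
rewrite (bigD1 k) //= mxE !eqxx mulr1 big1 ?addr0 // => i ik.
by rewrite mxE (negbTE ik) andbF mulr0.
Qed.

Lemma extremal_rank : \rank c = n.
Proof.
apply/eqP; rewrite -/(row_free c); apply/row_freeP.
exists (\matrix_(j, i) ((j : nat) == i.+1)%:R); apply/matrixP => i k; rewrite !mxE.
have kn : (k.+1 < n.+2)%N by rewrite ltnS ltnW // ltnS.
rewrite (bigD1 (Ordinal kn)) //= !mxE /= eqxx mulr1 eqSS (ltn_eqF (ltn_ord k)).
rewrite eqSS eq_sym big1 ?addr0 // => j; rewrite -val_eqE /= => /negbTE jk.
by rewrite !mxE jk mulr0.
Qed.

Let F := system a c.
Let T : laurent K n := 1 - laurentX K (const_mx (-1)).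

Lemma extremal_equation i :
  F i = laurent_poly 'X_i - (1 + laurentC K n (v i) * T).
Proof.
have kn : (i.+1 < n.+2)%N by rewrite ltnS ltnW // ltnS.
have c0 : c i 0 = - (1 + v i) by rewrite mxE.
have cm : c i ord_max = v i by rewrite mxE eqxx.
have ck : c i (Ordinal kn) = 1.
  by rewrite mxE /= eqSS (ltn_eqF (ltn_ord i)) eqxx.
have cE j : j != 0 -> j != ord_max -> j != Ordinal kn -> c i j = 0.
  rewrite -!val_eqE /= => j0 jm ji.
  by rewrite mxE (negbTE j0) (negbTE jm) (negbTE ji).
rewrite /F /system (bigD1 0) // (bigD1 ord_max) // (bigD1 (Ordinal kn)); last first.
  by rewrite -!val_eqE /= eqSS (ltn_eqF (ltn_ord i)).
rewrite big1 => [|j /andP[/andP[j0 jm] jk]]; last first.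
  by rewrite cE // rmorph0 mul0r.
rewrite c0 cm ck.
rewrite (rmorphN (laurentC K n)) (rmorphD (laurentC K n)) !(rmorph1 (laurentC K n)).
rewrite extremal_support_first extremal_support_last (@extremal_support_mid i) //.
rewrite laurentX0 laurentX_delta /T.
exact: extremal_identity.
Qed.

Lemma inverse_monomial : (1 - T) * \prod_i laurent_poly 'X_i = 1.
Proof.
rewrite /T opprB addrC subrK.
under eq_bigr do rewrite -laurentX_delta.
rewrite -laurentX_sum -laurentXD (_ : _ + _ = 0) ?laurentX0 //.
apply/rowP => k; rewrite !mxE summxE (bigD1 k) //= mxE !eqxx big1 ?addr0 //.
by move=> i ik; rewrite mxE eq_sym (negbTE ik) andbF.
Qed.

Lemma extremal_isolated : isolated_solution a c pt.
Proof.
have T0 : laurent_eval pt T = 0 by rewrite rmorphB rmorph1 /= laurent_eval1X subrr.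
split.
  apply/is_solutionE => i; rewrite -/F extremal_equation rmorphB rmorphD rmorphM /=.
  by rewrite T0 mulr0 rmorph1 addr0 laurent_eval_poly mevalXU mxE subrr.
exists 1; first exact: ltr01.
move=> y _ /is_solutionE ysol.
set t := laurent_eval y T.
have yE i : (y : 'rV_n) 0 i = 1 + v i * t.
  have := ysol i; rewrite -/F extremal_equation rmorphB rmorphD rmorphM /=.
  rewrite rmorph1 laurent_evalC laurent_eval_poly mevalXU => /eqP.
  by rewrite subr_eq0 => /eqP.
have t0 : t = 0.
  have := congr1 (laurent_eval y) inverse_monomial.
  rewrite rmorphM rmorphB rmorph_prod rmorph1 /= -/t.
  under eq_bigr => i _ do rewrite laurent_eval_poly mevalXU yE -[_ + _]expr1.
  rewrite -(lin_prod_horner v (fun=> 1%N)) => e.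
  have := congr1 (fun p => p.[t]) v_geom; rewrite hornerM !hornerD !hornerN.
  have e1 : laurent_eval y 1 = 1 by exact: rmorph1.
  rewrite hornerX hornerXn hornerC e e1 => h; apply/eqP.
  by rewrite -[_ == 0]andTb -(expf_eq0 _ n.+1) -[_ ^+ _](subKr 1) -h subrr.
by apply/val_inj/rowP => i; rewrite yE t0 mulr0 addr0 mxE.
Qed.

Lemma extremal_germX i : germ F pt (laurent_poly 'X_i)
  = germ F pt (1 + laurentC K n (v i) * T).
Proof.
apply: germ_congr; apply/gen_idealP; exists (fun j => (j == i)%:R).
rewrite -extremal_equation (bigD1 i) //= eqxx mul1r big1 ?addr0 // => j.
by move/negbTE ->; rewrite mul0r.
Qed.

Lemma extremal_nilpotent : germ F pt T ^+ n.+1 = 0.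
Proof.
have geo : (1 - T) * eval_at T (lin_prod v (fun=> 1%N)) = 1 - T ^+ n.+1.
  have one : eval_at T 1 = 1 by rewrite /eval_at rmorph1 hornerC.
  have XT : eval_at T 'X = T by rewrite -['X]expr1 eval_atXn expr1.
  by rewrite -eval_atXn -{1}XT -one -!eval_atB -eval_atM v_geom.
have gX i : germ F pt (laurentX K (delta_mx 0 i))
    = germ F pt (1 + laurentC K n (v i) * T).
  by rewrite laurentX_delta extremal_germX.
have prodE := image_lin_prod gX (fun=> 1%N).
have e : germ F pt (1 - T ^+ n.+1) = germ F pt 1.
  transitivity (germ F pt ((1 - T) * \prod_i laurent_poly 'X_i)); last first.
    by rewrite inverse_monomial.
  rewrite -geo 2!(rmorphM (germ F pt)) prodE; congr (_ * germ F pt _).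
  by apply: eq_bigr => i _; rewrite expr1 laurentX_delta.
rewrite -(rmorphXn (germ F pt)) -[T ^+ _](subKr 1) (rmorphB (germ F pt)) e.
exact: subrr.
Qed.

(** The parametrization [x_i = 1 + v_i X] of the line which carries the scheme of
    solutions. *)
Lemma substitution_exists : exists sg : {rmorphism {mpoly K[n]} -> {poly K}},
  [/\ forall z, sg z%:MP = z%:P, forall i, sg 'X_i = lin_factor v i
    & forall p, (sg p).[0] = p.@[(pt : 'rV_n) 0]].
Proof.
exists (mmap (@polyC K) (lin_factor v)); split=> [z|i|p].
- exact: mmapC.
- by rewrite /= mmapX mmap1U.
rewrite /meval /mmap horner_sum; apply: eq_bigr => m _.
rewrite hornerM hornerC /mmap1 horner_prod; congr (_ * _); apply: eq_bigr => i _.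
by rewrite horner_exp !hornerE mxE.
Qed.

(** Otherwise [u * T^n] would be in the ideal of the equations, with [u] nonzero at
    the point. Cleared of denominators and restricted to the line
    [x_i = 1 + v_i X], the equations become multiples of [X^(n+1)], whereas [u * T^n]
    becomes [X^n] times a polynomial with nonzero constant term. *)
Lemma extremal_T_neq0 : germ F pt T ^+ n <> 0.
Proof.
rewrite -(rmorphXn (germ F pt)) => /germ_eq0[u u0 /gen_idealP[g eg]].
have [M [M0 [p pE]]] :=
  clear_denominators (fun o => if o is Some i then g i else u) pt.
pose Y : {mpoly K[n]} := \prod_i 'X_i.
have YT : laurent_poly Y * T = laurent_poly (Y - 1).
  have := inverse_monomial; rewrite -rmorph_prod -/Y rmorphB rmorph1.
  exact: mul_complement.
have YF i : laurent_poly Y * F i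
    = laurent_poly (Y * 'X_i - Y - (v i)%:MP * (Y - 1)).
  rewrite extremal_equation mul_equation YT.
  by rewrite !rmorphB !rmorphM rmorphB.
have lpM q1 q2 :
    laurent_poly (q1 * q2) = laurent_poly q1 * laurent_poly q2 :> laurent K n.
  exact: rmorphM.
have lpXn q k : laurent_poly (q ^+ k) = laurent_poly q ^+ k :> laurent K n.
  exact: rmorphXn.
have lpS (f : 'I_n -> {mpoly K[n]}) :
    laurent_poly (\sum_i f i) = \sum_i laurent_poly (f i) :> laurent K n.
  exact: rmorph_sum.
have eq : p None * (Y - 1) ^+ n * Y =
    \sum_i p (Some i) * (Y * 'X_i - Y - (v i)%:MP * (Y - 1)) * Y ^+ n.
  apply: laurent_poly_inj.
  rewrite !lpM lpXn -YT -pE lpS clear_left eg mulr_suml.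
  apply: eq_bigr => i _; rewrite -clear_right lpM lpM lpXn.
  by rewrite -YF -pE.
pose E := lin_prod v (fun=> 1%N).
have [sg [sC sX s0]] := substitution_exists.
have sY : sg Y = E.
  by rewrite /Y rmorph_prod; apply: eq_bigr => i _; rewrite sX expr1.
have sF i : sg (Y * 'X_i - Y - (v i)%:MP * (Y - 1)) = (v i)%:P * 'X^(n.+1).
  rewrite !(rmorphB sg) !(rmorphM sg) (rmorphB sg) (rmorph1 sg) sX sY sC.
  rewrite -['X^_](subKr 1) -v_geom -/E /lin_factor -mul_polyC; ring.
(* The factor [(1 - 'X) ^+ n] turns [(E - 1) ^+ n], which is [T ^+ n] on the
   line without its denominator, into ['X^n] times a polynomial with constant
   term 1. *)
have := congr1 (fun q => (1 - 'X) ^+ n * sg q) eq.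
rewrite 2!(rmorphM sg) (rmorphXn sg) (rmorphB sg) (rmorph1 sg) (rmorph_sum sg) sY.
under eq_bigr => i _ do rewrite 2!(rmorphM sg) (rmorphXn sg) sF sY.
have hE : (1 - 'X) * (E - 1) = 'X * (1 - 'X^n).
  by rewrite mulrBr v_geom mulrBr -exprS; ring.
have -> : \sum_(i < n) sg (p (Some i)) * ((v i)%:P * 'X^(n.+1)) * E ^+ n
    = 'X^n * ('X * \sum_(i < n) sg (p (Some i)) * (v i)%:P * E ^+ n).
  rewrite mulrA -exprSr mulr_sumr; apply: eq_bigr => i _; ring.
have -> : (1 - 'X) ^+ n * (sg (p None) * (E - 1) ^+ n * E)
    = 'X^n * ((1 - 'X^n) ^+ n * sg (p None) * E).
  transitivity (((1 - 'X) * (E - 1)) ^+ n * sg (p None) * E).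
    by rewrite exprMn; ring.
  by rewrite hE exprMn !mulrA.
rewrite [X in _ = X -> _]mulrCA.
have Xn0 : 'X^n != 0 :> {poly K} by rewrite -size_poly_gt0 size_polyXn.
move/(mulfI Xn0)/(congr1 (fun q => q.[0])).
rewrite !hornerM horner_exp hornerD hornerN hornerXn hornerC hornerX.
rewrite expr0n gtn_eqF // subr0 expr1n mul1r lin_prod_horner0 mulr1 s0 mul0r.
rewrite mulr0; apply/eqP; rewrite -laurent_eval_poly -(pE None).
have -> : laurent_eval pt (u * laurent_poly M)
    = laurent_eval pt u * laurent_eval pt (laurent_poly M) by exact: rmorphM.
by rewrite laurent_eval_poly mulf_neq0.
Qed.

Lemma extremal_multiplicity : multiplicity F pt n.+1.
Proof.
have coord i : eqmodr (germ F pt T) (germ F pt (laurent_poly 'X_i)) 1.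
  exists (germ F pt (laurentC K n (v i))).
  rewrite extremal_germX (rmorphD (germ F pt)) (rmorphM (germ F pt)).
  by rewrite (rmorph1 (germ F pt)) [germ F pt T * _]mulrC.
have [d [dim dn Td0]] := multiplicity_uniformizer coord extremal_nilpotent.
suff <- : d = n.+1 by [].
apply/eqP; rewrite eqn_leq dn ltnNge; apply/negP => led.
exact: extremal_T_neq0 (expr_eq0_le led Td0).
Qed.

End ExtremalSystem.

(** * The maximal multiplicity *)

Theorem theorem8p1 (R : realType) (n : nat) (n_ge1 : (1 <= n)%N) :
  (exists (a : 'I_n.+2 -> 'rV[int]_n) (c : 'M[R[i]]_(n, n.+2)),
     [/\ injective a, ~ in_affine_hyperplane R a, \rank c = n,
         isolated_solution a c (torus1 R[i] n)
       & multiplicity (system a c) (torus1 R[i] n) n.+1])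
  /\
  (forall (a : 'I_n.+2 -> 'rV[int]_n) (c : 'M[R[i]]_(n, n.+2)),
     injective a -> ~ in_affine_hyperplane R a -> \rank c = n ->
     isolated_solution a c (torus1 R[i] n) ->
     exists2 d : nat,
       multiplicity (system a c) (torus1 R[i] n) d & (d <= n.+1)%N).
Proof.
split; last by move=> a c _ na rc iso; exact: multiplicity_bound.
have [v v_geom] := lin_prod_geometric R[i] n.
exists (@extremal_support n), (extremal_coef v); split.
- exact: extremal_support_inj.
- exact: extremal_support_spans.
- exact: extremal_rank.
- exact: extremal_isolated v_geom.
- exact: extremal_multiplicity.
Qed.
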